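(* For the quantum group $\mathfrak{D}$ at $\mathbb{S}_3$ attached to the 12-dimensional Fomin–Kirillov algebra, the Verma modules $\mathsf{M}(e,-)$, $\mathsf{M}(\sigma,+)$, $\mathsf{M}(\tau,1)$ and $\mathsf{M}(\tau,2)$ are simple $\mathfrak{D}$-modules. Therefore $\mathsf{L}(g,\varrho)\simeq\mathsf{S}(g,\varrho)$ holds for these weights.
   Context: $\Bbbk$ is an algebraically closed field of characteristic zero, $\zeta\in\Bbbk$ a fixed primitive cube root of $1$; $\sigma=(12)$, $\tau=(123)$ in $\mathbb{S}_3$, permutations composed right to left, so $\sigma\tau=(23)$, $\sigma\tau^2=(13)$. $V=\Bbbk\{x_{(12)},x_{(23)},x_{(13)}\}$ is the Yetter–Drinfeld module over $\Bbbk\mathbb{S}_3$ with $g\cdot x_{(ij)}=\mathrm{sgn}(g)x_{g(ij)g^{-1}}$ and coaction $x_{(ij)}\mapsto(ij)\otimes x_{(ij)}$. Its Nichols algebra $\mathfrak{B}(V)$ is the 12-dimensional Fomin–Kirillov algebra (top degree 4). $\mathfrak{D}$ is the Drinfeld double of the bosonization $\mathfrak{B}(V)\#\Bbbk\mathbb{S}_3$. Explicitly, $\mathfrak{D}$ is the algebra generated by $x_{(ij)}$, $y_{(ij)}$ (transpositions $(ij)$) and $g,\delta_g$ ($g\in\mathbb{S}_3$), where the $g$ multiply as in $\mathbb{S}_3$, the $\delta_g$ are orthogonal idempotents with sum $1$, and, for distinct $i,j,k$ and $g,h\in\mathbb{S}_3$: $x_{(ij)}^2=0$, $x_{(ij)}x_{(ik)}+x_{(jk)}x_{(ij)}+x_{(ik)}x_{(jk)}=0$;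 the same relations for the $y$'s; $\delta_hg=g\delta_{g^{-1}hg}$; $gx_{(ij)}=\mathrm{sgn}(g)x_{g(ij)g^{-1}}g$; $\delta_hx_{(ij)}=x_{(ij)}\delta_{(ij)h}$; $\delta_gy_{(ij)}=y_{(ij)}\delta_{(ij)g}$; $y_{(ij)}g=\mathrm{sgn}(g)\,g\,y_{g^{-1}(ij)g}$; $y_{(ij)}x_{(ij)}+x_{(ij)}y_{(ij)}=1+(ij)(\delta_{(ij)}-\delta_e)$; $y_{(ik)}x_{(ij)}+x_{(ij)}y_{(jk)}=(ij)(\delta_{(ik)}-\delta_{(ik)(ij)})$. The $g,\delta_g$ generate the Drinfeld double $\mathfrak{D}(\mathbb{S}_3)$ of $\Bbbk\mathbb{S}_3$; $\overline V=\Bbbk\{y_{(ij)}\}$ generates $\mathfrak{B}(\overline V)$; multiplication $\mathfrak{B}(V)\otimes\mathfrak{D}(\mathbb{S}_3)\otimes\mathfrak{B}(\overline V)\to\mathfrak{D}$ is a linear isomorphism. Simple $\mathfrak{D}(\mathbb{S}_3)$-modules (''degree $h$'' means $\delta_h$ acts as identity and other $\delta$'s by $0$): $M(e,\pm)=\Bbbk|e\rangle$ in degree $e$ with $g$ acting by $1$, resp. $\mathrm{sgn}(g)$; $M(e,\rho)$, the 2-dimensional irreducible $\mathbb{S}_3$-module in degree $e$; $M(\sigma,\pm)$ with basis $|12\rangle,|23\rangle,|13\rangle$, $|ij\rangle$ of degree $(ij)$, $g|ij\rangle=|g(ij)g^{-1}\rangle$ for $+$ and $g|ij\rangle=\mathrm{sgn}(g)|g(ij)g^{-1}\rangle$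 for $-$; $M(\tau,\ell)$, $\ell=0,1,2$, with basis $|\tau\rangle,|\tau^{-1}\rangle$, $|\tau^{\pm1}\rangle$ of degree $\tau^{\pm1}$, $\tau^t|\tau^{\pm1}\rangle=\zeta^{\pm t\ell}|\tau^{\pm1}\rangle$, $\sigma\tau^t|\tau^{\pm1}\rangle=\zeta^{\pm t\ell}|\tau^{\mp1}\rangle$. Let $\mathfrak{D}^{\ge0}$ be the subalgebra generated by $\mathfrak{D}(\mathbb{S}_3)$ and $\overline V$; a simple $\mathfrak{D}(\mathbb{S}_3)$-module $M(g,\varrho)$ is a $\mathfrak{D}^{\ge0}$-module with $\overline V$ acting by $0$. The Verma module is $\mathsf{M}(g,\varrho)=\mathfrak{D}\otimes_{\mathfrak{D}^{\ge0}}M(g,\varrho)=\mathfrak{B}(V)\otimes M(g,\varrho)$. It has a unique maximal $\mathfrak{D}$-submodule; $\mathsf{L}(g,\varrho)$ is its head (unique simple quotient) and $\mathsf{S}(g,\varrho)$ its socle. *)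

(* Defs.v *)
From HB Require Import structures.
From mathcomp Require Import all_boot all_order all_fingroup all_algebra.
From mathcomp Require Import boolp.
From mathcomp Require Import monalg.

Set Implicit Arguments.
Unset Strict Implicit.
Unset Printing Implicit Defensive.

Import GRing.Theory.

Local Open Scope ring_scope.
Local Open Scope quotient_scope.

Record submodule (R : nzRingType) (V : lmodType R) := Submodule {
  subm_pred :> {pred V};
  subm_closed : GRing.submod_closed subm_pred
}.

Section Submodules.
Variables (R : nzRingType) (V : lmodType R).
Implicit Types U W : submodule V.

Lemma subm_zmod_closed U : zmod_closed (subm_pred U).
Proof. exact: GRing.submod_closedB (subm_closed U). Qed.

HB.instance Definition _ U :=
  GRing.isZmodClosed.Build V (subm_pred U) (subm_zmod_closed U).

Lemma subm_scale U a v : v \in subm_pred U -> a *: v \in subm_pred U.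
Proof.
by case: (subm_closed U) => U0 Ul vU; rewrite -[a *: v]addr0; apply: Ul.
Qed.

Definition quotmod U : Type := Quotient.quot (subm_pred U).

HB.instance Definition _ U := GRing.Zmodule.on (quotmod U).

Definition quotmod_pi U (v : V) : quotmod U :=
  \pi_(Quotient.quot (subm_pred U)) v.

Lemma quotmod_piP U v w :
  (quotmod_pi U v == quotmod_pi U w) = (v - w \in subm_pred U).
Proof. by rewrite Quotient.idealrBE. Qed.

Lemma quotmod_piD U v w :
  quotmod_pi U (v + w) = quotmod_pi U v + quotmod_pi U w.
Proof. exact: (@Quotient.pi_add _ (subm_pred U)). Qed.

Definition quotmod_repr U (q : quotmod U) : V :=
  generic_quotient.repr (q : Quotient.quot (subm_pred U)).

Lemma quotmod_reprK U : cancel (@quotmod_repr U) (quotmod_pi U).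
Proof. by move=> q; rewrite /quotmod_pi /quotmod_repr reprK. Qed.

Definition quotmod_scale U (a : R) (q : quotmod U) : quotmod U :=
  quotmod_pi U (a *: quotmod_repr q).

Lemma quotmod_scaleE U a v :
  quotmod_scale a (quotmod_pi U v) = quotmod_pi U (a *: v).
Proof.
apply/eqP; rewrite quotmod_piP -scalerBr subm_scale // -quotmod_piP.
by rewrite quotmod_reprK.
Qed.

Lemma quotmod_scaleA U a b (q : quotmod U) :
  quotmod_scale a (quotmod_scale b q) = quotmod_scale (a * b) q.
Proof. by rewrite -[q]quotmod_reprK !quotmod_scaleE scalerA. Qed.

Lemma quotmod_scale1 U : left_id 1 (@quotmod_scale U).
Proof. by move=> q; rewrite -[q]quotmod_reprK quotmod_scaleE scale1r. Qed.

Lemma quotmod_scaleDr U : right_distributive (@quotmod_scale U) +%R.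
Proof.
move=> a q r; rewrite -[q]quotmod_reprK -[r]quotmod_reprK.
by rewrite -quotmod_piD !quotmod_scaleE scalerDr quotmod_piD.
Qed.

Lemma quotmod_scaleDl U (q : quotmod U) :
  {morph (@quotmod_scale U)^~ q : a b / a + b}.
Proof.
move=> a b; rewrite -[q]quotmod_reprK.
by rewrite !quotmod_scaleE scalerDl quotmod_piD.
Qed.

HB.instance Definition _ U := GRing.Zmodule_isLmodule.Build R (quotmod U)
  (@quotmod_scaleA U) (@quotmod_scale1 U) (@quotmod_scaleDr U)
  (@quotmod_scaleDl U).

Record submodType U := SubmodElt {
  submod_val :> V;
  submod_valP : submod_val \in subm_pred U
}.

HB.instance Definition _ U := [isSub for @submod_val U].
HB.instance Definition _ U := [Choice of submodType U by <:].
HB.instance Definition _ U :=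
  GRing.SubChoice_isSubLmodule.Build R V (subm_pred U) (submodType U)
    (GRing.submod_closed_semi (subm_closed U)).

Inductive submod_gen (S : V -> Prop) : V -> Prop :=
| submod_gen_in v : S v -> submod_gen S v
| submod_gen0 : submod_gen S 0
| submod_genD v w : submod_gen S v -> submod_gen S w -> submod_gen S (v + w)
| submod_genZ a v : submod_gen S v -> submod_gen S (a *: v).

Lemma submod_gen_closed (S : V -> Prop) :
  GRing.submod_closed (fun v => `[< submod_gen S v >]).
Proof.
split=> [|a v w]; first by apply/asboolP; apply: submod_gen0.
rewrite !unfold_in => /asboolP Sv /asboolP Sw; apply/asboolP.
by apply: submod_genD => //; apply: submod_genZ.
Qed.

Definition span_submod (S : V -> Prop) : submodule V :=
  Submodule (submod_gen_closed S).

Definition maximal_submod U : Prop :=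
  ~ (U =i predT) /\
  (forall W, {subset U <= W} -> W =i U \/ W =i predT).

Lemma radical_closed :
  GRing.submod_closed (fun v => `[< forall U, maximal_submod U -> v \in U >]).
Proof.
split=> [|a v w]; first by apply/asboolP => U _; case: (subm_closed U).
rewrite !unfold_in => /asboolP Hv /asboolP Hw; apply/asboolP => U mU.
by case: (subm_closed U) => _; apply; [apply: Hv | apply: Hw].
Qed.

(* Intersection of the maximal submodules; when there is exactly one of them,
   as in a Verma module, this is that submodule. *)
Definition radical : submodule V := Submodule radical_closed.

End Submodules.

Definition simple_module (R : nzRingType) (V : lmodType R) : Prop :=
  (exists v : V, v != 0) /\
  (forall U : submodule V, U =i pred1 0 \/ U =i predT).

Definition socle (R : nzRingType) (V : lmodType R) : submodule V :=
  span_submod (fun v => exists2 U : submodule V,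
                          simple_module (submodType U) & v \in U).

Definition isomorphic (R : nzRingType) (V W : lmodType R) : Prop :=
  exists f : {linear V -> W}, bijective f.

(* The points 1, 2, 3 are 0, 1, 2 : 'I_3.  The group law of 'S_3 in the
   library composes left to right; the law used here composes right to left. *)
Definition mul3 (g h : 'S_3) : 'S_3 := (h * g)%g.

Local Notation "g *o h" := (mul3 g h) (at level 40, left associativity).

Lemma mul3E g h i : (g *o h) i = g (h i).
Proof. exact: permM. Qed.

Definition conj3 (g t : 'S_3) : 'S_3 := g *o t *o g^-1%g.

Definition is_transp (t : 'S_3) : bool :=
  [exists i, exists j, (i != j) && (t == tperm i j)].

Lemma tperm_is_transp (i j : 'I_3) : i != j -> is_transp (tperm i j).
Proof. by move=> ij; apply/existsP; exists i; apply/existsP; exists j; rewrite ij /=. Qed.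

Lemma conj3_is_transp g t : is_transp t -> is_transp (conj3 g t).
Proof.
case/existsP=> i /existsP[j /andP[ij /eqP->]].
rewrite (_ : conj3 g _ = tperm (g i) (g j)); last first.
  by rewrite -tpermJ conjgE.
by apply: tperm_is_transp; rewrite (inj_eq perm_inj).
Qed.

Definition transp := {t : 'S_3 | is_transp t}.

Definition tr (i j : 'I_3) (ij : i != j) : transp :=
  exist _ (tperm i j) (tperm_is_transp ij).

Definition conjT (g : 'S_3) (t : transp) : transp :=
  exist _ (conj3 g (val t)) (conj3_is_transp g (valP t)).

Definition sigma : 'S_3 := tperm 0 1.
(* i |-> i + 1 modulo 3, that is (1 2 3) *)
Definition tau : 'S_3 := perm (@addIr _ (1 : 'I_3)).

(* The t in {0, 1, 2} such that g = tau^t or g = sigma tau^t. *)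
Definition tau_exp (g : 'S_3) : nat :=
  if [pick t : 'I_3 | (g == (tau ^+ t)%g) || (g == sigma *o (tau ^+ t)%g)]
  is Some t then t else 0.

Lemma sigma_tau : sigma *o tau = tperm 1 2.
Proof.
apply/permP => i; rewrite mul3E !permE /=.
by case: i => [[|[|[|i]]] ilt] //; apply/val_inj.
Qed.

Lemma odd_tau : odd_perm tau = false.
Proof.
have := congr1 (@odd_perm 'I_3) sigma_tau; rewrite /mul3 odd_permM !odd_tperm /=.
by case: (odd_perm tau).
Qed.

Lemma tau_exp_ex (g : 'S_3) :
  exists t : 'I_3, (g == (tau ^+ t)%g) || (g == sigma *o (tau ^+ t)%g).
Proof.
have E (h : 'S_3) : g 0 = h 0 -> g 1 = h 1 -> g = h.
  move=> h0 h1; apply/permP => i.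
  have [->//|i0] := eqVneq i 0; have [->//|i1] := eqVneq i 1.
  have g0 := inj_eq (@perm_inj _ g) i 0; have g1 := inj_eq (@perm_inj _ g) i 1.
  have k0 := inj_eq (@perm_inj _ h) i 0; have k1 := inj_eq (@perm_inj _ h) i 1.
  have k01 := inj_eq (@perm_inj _ h) 0 1.
  move: g0 g1 k0 k1 k01; rewrite (negbTE i0) (negbTE i1) h0 h1.
  case: (g i) (h i) (h 0) (h 1) => [[|[|[|?]]] ?] [[|[|[|?]]] ?] [[|[|[|?]]] ?]
    [[|[|[|?]]] ?] //= *; exact/val_inj.
have g01 := inj_eq (@perm_inj _ g) 0 1.
suff [t [b gE]] : exists t : 'I_3, exists b : bool,
    g = if b then sigma *o (tau ^+ t)%g else (tau ^+ t)%g.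
  by exists t; apply/orP; case: b gE => gE; [right|left]; apply/eqP.
case g0E: (g 0) g01 => [[|[|[|?]]] ?] //; case g1E: (g 1) => [[|[|[|?]]] ?] // _.
- exists 0; exists false.
  by apply: E; rewrite ?g0E ?g1E ?mul3E /= ?expgS ?expg0 !permE /= ?permE; apply: val_inj.
- exists 1; exists true.
  by apply: E; rewrite ?g0E ?g1E ?mul3E /= ?expgS ?expg0 !permE /= ?permE; apply: val_inj.
- exists 0; exists true.
  by apply: E; rewrite ?g0E ?g1E ?mul3E /= ?expgS ?expg0 !permE /= ?permE; apply: val_inj.
- exists 1; exists false.
  by apply: E; rewrite ?g0E ?g1E ?mul3E /= ?expgS ?expg0 !permE /= ?permE; apply: val_inj.
- exists 2; exists false.
  by apply: E; rewrite ?g0E ?g1E ?mul3E /= ?expgS ?expg0 !permE /= ?permE; apply: val_inj.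
- exists 2; exists true.
  by apply: E; rewrite ?g0E ?g1E ?mul3E /= ?expgS ?expg0 !permE /= ?permE; apply: val_inj.
Qed.

Lemma tau_expP (g : 'S_3) :
  g = if odd_perm g then sigma *o (tau ^+ tau_exp g)%g else (tau ^+ tau_exp g)%g.
Proof.
have oX n : odd_perm (tau ^+ n)%g = false.
  by elim: n => [|n IH]; rewrite ?odd_perm1 // expgS odd_permM odd_tau IH.
rewrite /tau_exp; case: pickP => [t|H]; last first.
  by case: (tau_exp_ex g) => t; rewrite H.
by case/orP=> /eqP ->; rewrite ?(oX, odd_permM, odd_tperm).
Qed.

Definition sgn3 (k : nzRingType) (g : 'S_3) : k := (-1) ^+ odd_perm g.

Definition Dgen : choiceType := ((transp + transp) + ('S_3 + 'S_3))%type.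

Section Double.
Variable k : fieldType.

Local Notation sgn := (sgn3 k).

(* The defining relations a = b of D for elements x_t = X t, y_t = Y t,
   g = G g and delta_h = E h of an algebra A. *)
Inductive Drel (A : lalgType k) (X Y : transp -> A) (G E : 'S_3 -> A) :
    A -> A -> Prop :=
| Drel_gg g h : Drel X Y G E (G g * G h) (G (g *o h))
| Drel_g1 : Drel X Y G E (G 1%g) 1
| Drel_dd g h : Drel X Y G E (E g * E h) (if g == h then E g else 0)
| Drel_d1 : Drel X Y G E (\sum_h E h) 1
| Drel_xx t : Drel X Y G E (X t * X t) 0
| Drel_xxx i j l (ij : i != j) (il : i != l) (jl : j != l) :
    Drel X Y G E
      (X (tr ij) * X (tr il) + X (tr jl) * X (tr ij) + X (tr il) * X (tr jl)) 0
| Drel_yy t : Drel X Y G E (Y t * Y t) 0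
| Drel_yyy i j l (ij : i != j) (il : i != l) (jl : j != l) :
    Drel X Y G E
      (Y (tr ij) * Y (tr il) + Y (tr jl) * Y (tr ij) + Y (tr il) * Y (tr jl)) 0
| Drel_dg h g : Drel X Y G E (E h * G g) (G g * E (g^-1%g *o h *o g))
| Drel_gx g t : Drel X Y G E (G g * X t) (sgn g *: (X (conjT g t) * G g))
| Drel_dx h t : Drel X Y G E (E h * X t) (X t * E (val t *o h))
| Drel_dy h t : Drel X Y G E (E h * Y t) (Y t * E (val t *o h))
| Drel_yg t g :
    Drel X Y G E (Y t * G g) (sgn g *: (G g * Y (conjT g^-1%g t)))
| Drel_yx_same t :
    Drel X Y G E (Y t * X t + X t * Y t) (1 + G (val t) * (E (val t) - E 1%g))
| Drel_yx_diff i j l (ij : i != j) (il : i != l) (jl : j != l) :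
    Drel X Y G E (Y (tr il) * X (tr ij) + X (tr ij) * Y (tr jl))
      (G (tperm i j) * (E (tperm i l) - E (tperm i l *o tperm i j))).

Lemma transp_neq1 (t : transp) : val t != 1%g.
Proof.
case: t => t /= /existsP[i /existsP[j /andP[ij /eqP->]]].
by apply/eqP => /permP /(_ i); rewrite tpermL perm1 => /esym /eqP; apply/negP.
Qed.

Lemma Drel_trivial (A : lalgType k) (X Y : transp -> A) (G E : 'S_3 -> A)
    (eps : {rmorphism A -> k}) :
  (forall c a, eps (c *: a) = c * eps a) ->
  (forall t, eps (X t) = 0) -> (forall t, eps (Y t) = 0) ->
  (forall g, eps (G g) = 1) -> (forall h : 'S_3, eps (E h) = (h == 1%g)%:R) ->
  forall a b : A, Drel X Y G E a b -> eps a = eps b.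
Proof.
move=> epsZ epsX epsY epsG epsE a b.
have e1 (t : transp) : (val t == 1%g) = false by apply/negbTE/transp_neq1.
pose cE := (rmorphM eps, rmorphD eps, rmorphN eps, rmorph0 eps, rmorph1 eps,
            epsZ, epsX, epsY, epsG, epsE).
case=> [g h||g h||t|i j l ij il jl|t|i j l ij il jl|h g|g t|h t|g t|t g|t
       |i j l ij il jl]; rewrite ?cE ?(mulr0, mul0r, mulr1, mul1r, addr0) //.
- case: (eqVneq g h) => [->|gh]; first by rewrite cE -natrM mulnb andbb.
  rewrite cE -natrM mulnb; case: eqP => // g1; case: eqP => // h1.
  by move: gh; rewrite g1 h1 eqxx.
- rewrite rmorph_sum (bigD1 1%g) //= epsE eqxx.
  by rewrite big1 ?addr0 // => h /negbTE h1; rewrite epsE h1.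
- congr (_%:R); congr nat_of_bool; apply/eqP/eqP => [->|].
    by rewrite /mul3 mul1g mulgV.
  rewrite /mul3 => H; apply: (@mulIg _ g^-1%g); rewrite mul1g.
  by apply: (@mulgI _ g); rewrite H mulgV.
- by rewrite e1 eqxx sub0r subrr.
- rewrite (e1 (tr il)) (_ : (_ == _) = false) ?subrr //.
  apply/negbTE/eqP => /permP /(_ j); rewrite mul3E perm1 tpermR tpermL.
  by move=> /esym/eqP; rewrite eq_sym; apply/negP; rewrite eq_sym.
Qed.

Definition freeD := {malg k[{fmonom Dgen}]}.

Definition fx (t : transp) : freeD := << fmu (inl (inl t) : Dgen) >>.
Definition fy (t : transp) : freeD := << fmu (inl (inr t) : Dgen) >>.
Definition fg (g : 'S_3) : freeD := << fmu (inr (inl g) : Dgen) >>.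
Definition fd (h : 'S_3) : freeD := << fmu (inr (inr h) : Dgen) >>.

Inductive Dideal : freeD -> Prop :=
| Dideal_rel a b : Drel fx fy fg fd a b -> Dideal (a - b)
| Dideal0 : Dideal 0
| DidealD a b : Dideal a -> Dideal b -> Dideal (a + b)
| DidealMl c a : Dideal a -> Dideal (c * a)
| DidealMr c a : Dideal a -> Dideal (a * c).

Definition Dideal_pred : {pred freeD} := fun a => `[< Dideal a >].

Lemma Dideal_zmod_closed : zmod_closed Dideal_pred.
Proof.
split=> [|a b]; first by apply/asboolP; apply: Dideal0.
rewrite !unfold_in => /asboolP Ia /asboolP Ib; apply/asboolP.
by apply: DidealD => //; rewrite -mulN1r; apply: DidealMl.
Qed.

HB.instance Definition _ :=
  GRing.isZmodClosed.Build freeD Dideal_pred Dideal_zmod_closed.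

(* The counit x, y |-> 0, g |-> 1, delta_g |-> [g = e]; used below only to
   see that 1 is not in the ideal. *)
Definition counit_gen (s : Dgen) : k :=
  match s with
  | inl _ => 0
  | inr (inl _) => 1
  | inr (inr h) => (h == 1%g)%:R
  end.

Definition counit_word (w : {fmonom Dgen}) : k := \prod_(s <- w) counit_gen s.

Lemma counit_word_morph : mmorphism counit_word.
Proof.
split=> [u v|]; rewrite /counit_word; last by rewrite fm1 big_nil.
by rewrite fmM big_cat.
Qed.

HB.instance Definition _ :=
  isMultiplicative.Build {fmonom Dgen} k counit_word counit_word_morph.

Definition counit (a : freeD) : k := mmap idfun counit_word a.

HB.instance Definition _ := GRing.RMorphism.copy counit (mmap idfun counit_word).

Lemma counitU s : counit << fmu s >> = counit_gen s.
Proof. by rewrite /counit mmapU /= mul1r /counit_word fmU big_seq1. Qed.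

Lemma counitZ c a : counit (c *: a) = c * counit a.
Proof. exact: mmapZ. Qed.

Lemma counit_Drel a b : Drel fx fy fg fd a b -> counit a = counit b.
Proof.
apply: (Drel_trivial (eps := counit)) => [c v|t|t|g|h]; last 4 first.
- exact: counitU.
- exact: counitU.
- exact: counitU.
- exact: counitU.
exact: counitZ.
Qed.

Lemma counit_Dideal a : Dideal a -> counit a = 0.
Proof.
elim=> [{}a b ab||{}a b _ a0 _ b0|c {}a _ a0|c {}a _ a0].
- by rewrite rmorphB /= (counit_Drel ab) subrr.
- exact: rmorph0.
- by rewrite rmorphD /= a0 b0 addr0.
- by rewrite rmorphM /= a0 mulr0.
- by rewrite rmorphM /= a0 mul0r.
Qed.

Lemma freeD_scalerAr (c : k) (a b : freeD) : c *: (a * b) = a * (c *: b).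
Proof.
suff cC (d : freeD) : d * malgC c = malgC c * d.
  by rewrite -!mul_malgC mulrA -cC -mulrA.
rewrite {1 2}[d]monalgE mulr_suml mulr_sumr; apply: eq_bigr => w _.
transitivity (<< d@_w * c *g mmul w mone >> : freeD); first exact: fgmulUU.
transitivity (<< c * d@_w *g mmul mone w >> : freeD).
  by rewrite mulm1 mul1m (mulrC c).
exact: (esym (@fgmulUU _ k c d@_w mone w)).
Qed.

Definition Dalg : Type := Quotient.quot Dideal_pred.

HB.instance Definition _ := GRing.Zmodule.on Dalg.

Definition Dpi (a : freeD) : Dalg := \pi_(Quotient.quot Dideal_pred) a.
Definition Drepr (a : Dalg) : freeD :=
  generic_quotient.repr (a : Quotient.quot Dideal_pred).

Lemma DreprK : cancel Drepr Dpi.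
Proof. by move=> a; rewrite /Dpi /Drepr reprK. Qed.

Lemma Dpi_eqP a b : (Dpi a = Dpi b) <-> Dideal (a - b).
Proof.
split=> [/eqP|ab]; first by rewrite -Quotient.idealrBE => /asboolP.
by apply/eqP; rewrite -Quotient.idealrBE; apply/asboolP.
Qed.

Lemma DpiD a b : Dpi (a + b) = Dpi a + Dpi b.
Proof. exact: (@Quotient.pi_add _ Dideal_pred). Qed.

Definition Done : Dalg := Dpi 1.
Definition Dmul (a b : Dalg) : Dalg := Dpi (Drepr a * Drepr b).
Definition Dscale (c : k) (a : Dalg) : Dalg := Dpi (c *: Drepr a).

Lemma DmulE a b : Dmul (Dpi a) (Dpi b) = Dpi (a * b).
Proof.
apply/Dpi_eqP.
have -> (a' b' : freeD) : a' * b' - a * b = (a' - a) * b' + a * (b' - b).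
  by rewrite mulrBl mulrBr addrA subrK.
apply: DidealD; [apply: DidealMr | apply: DidealMl];
  by apply/Dpi_eqP; rewrite DreprK.
Qed.

Lemma DscaleE c a : Dscale c (Dpi a) = Dpi (c *: a).
Proof.
apply/Dpi_eqP; rewrite -scalerBr -mul_malgC; apply: DidealMl.
by apply/Dpi_eqP; rewrite DreprK.
Qed.

Lemma DmulA : associative Dmul.
Proof.
by move=> a b c; rewrite -[a]DreprK -[b]DreprK -[c]DreprK !DmulE mulrA.
Qed.
Lemma Dmul1 : left_id Done Dmul.
Proof. by move=> a; rewrite -[a]DreprK /Done !DmulE mul1r. Qed.
Lemma Dmulr1 : right_id Done Dmul.
Proof. by move=> a; rewrite -[a]DreprK /Done !DmulE mulr1. Qed.
Lemma DmulDl : left_distributive Dmul +%R.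
Proof.
move=> a b c; rewrite -[a]DreprK -[b]DreprK -[c]DreprK.
by rewrite -DpiD !DmulE mulrDl DpiD.
Qed.
Lemma DmulDr : right_distributive Dmul +%R.
Proof.
move=> a b c; rewrite -[a]DreprK -[b]DreprK -[c]DreprK.
by rewrite -DpiD !DmulE mulrDr DpiD.
Qed.
Lemma Done_neq0 : Done != 0.
Proof.
apply/eqP => H; have/Dpi_eqP : Dpi 1 = Dpi 0.
  by rewrite -/Done H; apply: (@addrI _ (Dpi 0)); rewrite -DpiD !addr0.
rewrite subr0 => /counit_Dideal /eqP; rewrite rmorph1; apply/negP.
exact: oner_neq0.
Qed.

HB.instance Definition _ := GRing.Zmodule_isNzRing.Build Dalg
  DmulA Dmul1 Dmulr1 DmulDl DmulDr Done_neq0.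

Lemma DscaleA c d a : Dscale c (Dscale d a) = Dscale (c * d) a.
Proof. by rewrite -[a]DreprK !DscaleE scalerA. Qed.
Lemma Dscale1 : left_id 1 Dscale.
Proof. by move=> a; rewrite -[a]DreprK DscaleE scale1r. Qed.
Lemma DscaleDr : right_distributive Dscale +%R.
Proof.
move=> c a b; rewrite -[a]DreprK -[b]DreprK.
by rewrite -DpiD !DscaleE scalerDr DpiD.
Qed.
Lemma DscaleDl (a : Dalg) : {morph Dscale^~ a : c d / c + d}.
Proof. by move=> c d; rewrite -[a]DreprK !DscaleE scalerDl DpiD. Qed.

HB.instance Definition _ := GRing.Zmodule_isLmodule.Build k Dalg
  DscaleA Dscale1 DscaleDr DscaleDl.

Lemma DscaleAl (c : k) (a b : Dalg) : c *: (a * b) = c *: a * b.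
Proof.
rewrite -[a]DreprK -[b]DreprK; change (Dscale c (Dmul (Dpi (Drepr a)) (Dpi (Drepr b)))
  = Dmul (Dscale c (Dpi (Drepr a))) (Dpi (Drepr b))).
by rewrite !(DmulE, DscaleE) scalerAl.
Qed.

HB.instance Definition _ := GRing.Lmodule_isLalgebra.Build k Dalg DscaleAl.

Lemma DscaleAr (c : k) (a b : Dalg) : c *: (a * b) = a * (c *: b).
Proof.
rewrite -[a]DreprK -[b]DreprK; change (Dscale c (Dmul (Dpi (Drepr a)) (Dpi (Drepr b)))
  = Dmul (Dpi (Drepr a)) (Dscale c (Dpi (Drepr b)))).
by rewrite !(DmulE, DscaleE) freeD_scalerAr.
Qed.

HB.instance Definition _ := GRing.Lalgebra_isAlgebra.Build k Dalg DscaleAr.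

Definition Dx (t : transp) : Dalg := Dpi (fx t).
Definition Dy (t : transp) : Dalg := Dpi (fy t).
Definition Dg (g : 'S_3) : Dalg := Dpi (fg g).
Definition Dd (h : 'S_3) : Dalg := Dpi (fd h).

Record DS3_module := DS3Module {
  DS3_space :> lmodType k;
  DS3_g : 'S_3 -> DS3_space -> DS3_space;
  DS3_d : 'S_3 -> DS3_space -> DS3_space
}.

(* The subalgebra D^{>=0}. *)
Inductive Dge0 : Dalg -> Prop :=
| Dge0_g g : Dge0 (Dg g)
| Dge0_d h : Dge0 (Dd h)
| Dge0_y t : Dge0 (Dy t)
| Dge0_1 : Dge0 1
| Dge0_D a b : Dge0 a -> Dge0 b -> Dge0 (a + b)
| Dge0_M a b : Dge0 a -> Dge0 b -> Dge0 (a * b)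
| Dge0_Z c a : Dge0 a -> Dge0 (c *: a).

(* The graph of the action of D^{>=0} on M, with the y's acting by 0: the
   subalgebra of D x End(M) generated by the pairs (g, g), (delta_h, delta_h)
   and (y, 0). *)
Inductive Dge0_act (M : DS3_module) : Dalg -> (M -> M) -> Prop :=
| Dge0_act_g g : Dge0_act (Dg g) (DS3_g g)
| Dge0_act_d h : Dge0_act (Dd h) (DS3_d h)
| Dge0_act_y t : Dge0_act (Dy t) (fun _ => 0)
| Dge0_act_1 : Dge0_act 1 id
| Dge0_act_D a b f1 f2 : Dge0_act a f1 -> Dge0_act b f2 ->
    Dge0_act (a + b) (fun m => f1 m + f2 m)
| Dge0_act_M a b f1 f2 : Dge0_act a f1 -> Dge0_act b f2 ->
    Dge0_act (a * b) (fun m => f1 (f2 m))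
| Dge0_act_Z c a f : Dge0_act a f -> Dge0_act (c *: a) (fun m => c *: f m).

Lemma Dge0P (M : DS3_module) b : Dge0 b <-> exists f, Dge0_act (M := M) b f.
Proof.
split.
  elim=> [g|h|t||{}a {}b _ [f1 ?] _ [f2 ?]|{}a {}b _ [f1 ?] _ [f2 ?]|c {}a _ [f ?]].
  - by exists (DS3_g g); apply: Dge0_act_g.
  - by exists (DS3_d h); apply: Dge0_act_d.
  - by exists (fun _ => 0); apply: Dge0_act_y.
  - by exists id; apply: Dge0_act_1.
  - by exists (fun m => f1 m + f2 m); apply: Dge0_act_D.
  - by exists (fun m => f1 (f2 m)); apply: Dge0_act_M.
  - by exists (fun m => c *: f m); apply: Dge0_act_Z.
case=> f; elim=> [g|h|t||a c f1 f2 _ Ha _ Hc|a c f1 f2 _ Ha _ Hc|c a f1 _ Ha].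
- exact: Dge0_g.
- exact: Dge0_d.
- exact: Dge0_y.
- exact: Dge0_1.
- exact: Dge0_D.
- exact: Dge0_M.
- exact: Dge0_Z.
Qed.

(* D (x)_{D^{>=0}} M is the free left D-module on the symbols << m >> = 1 (x) m
   modulo additivity in m and b *: << m >> = << b m >> for b in D^{>=0}. *)
Inductive Verma_rel (M : DS3_module) : {malg Dalg[M]} -> Prop :=
| Verma_add m m' : Verma_rel (<< (m + m' : M) >> - << m >> - << m' >>)
| Verma_bal b f m : Dge0_act b f ->
    Verma_rel (b *: << (m : M) >> - << f m >>).

Definition Verma (M : DS3_module) : lmodType Dalg :=
  quotmod (span_submod (@Verma_rel M)).

Definition Lhead (M : DS3_module) : lmodType Dalg :=
  quotmod (radical (Verma M)).

Definition Ssocle (M : DS3_module) : lmodType Dalg :=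
  submodType (socle (Verma M)).

Definition ket (I : finType) (i : I) : {ffun I -> k^o} :=
  [ffun j => (j == i)%:R].

Definition lin_ext (I : finType) (F : I -> {ffun I -> k^o})
  (m : {ffun I -> k^o}) : {ffun I -> k^o} := \sum_i (m i : k) *: F i.

(* |i> has degree deg i, and g |i> = act g i. *)
Definition graded_module (I : finType) (deg : I -> 'S_3)
    (act : 'S_3 -> I -> {ffun I -> k^o}) : DS3_module :=
  @DS3Module {ffun I -> k^o} (fun g => lin_ext (act g))
    (fun h => lin_ext (fun i => if deg i == h then ket i else 0)).

Definition M_e_minus : DS3_module :=
  graded_module (fun _ : unit => 1%g) (fun g i => sgn g *: ket i).

Definition M_sigma_plus : DS3_module :=
  graded_module (fun t : transp => val t) (fun g t => ket (conjT g t)).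

(* true and false stand for |tau> and |tau^-1>. *)
Definition M_tau (zeta : k) (l : nat) : DS3_module :=
  graded_module (fun s : bool => if s then tau else tau^-1%g)
    (fun g s =>
       (if s then zeta ^+ (tau_exp g * l) else zeta ^- (tau_exp g * l))
         *: ket (if odd_perm g then ~~ s else s)).

End Double.

(* Main.v *)
(* Let x_top = x_(12) x_(23) x_(12) x_(13) span the top degree of B(V), and let
   y_top be the same word in the y's. For each of the four weights y_top x_top
   acts on M(g, rho) as a nonzero scalar (-12, -4, -3 and -3). A nonzero vector
   sum b_i (x) m_i of the Verma module can be multiplied by an element of B(V)
   to give x_top (x) m with m != 0, then by y_top to give a nonzero vector of
   M(g, rho), which generates everything.
   What has to be excluded is that the relations of D collapse the Verma module
   to 0. The matrices by which D should act on B(V) (x) M(g, rho) are computed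
   from the relations, and the defining relations of D are checked on them by
   evaluation; an intertwiner from this explicit module to the Verma module then
   reduces all other statements to such evaluations. *)
Require Import Defs.
From HB Require Import structures.
From mathcomp Require Import all_boot all_order all_fingroup all_algebra.
From mathcomp Require Import boolp monalg ring.

Set Implicit Arguments.
Unset Strict Implicit.
Unset Printing Implicit Defensive.

Import GRing.Theory.

Local Open Scope ring_scope.

(** * Simple modules *)

(** Permutations and field elements do not reduce under evaluation, so both are replaced by data
    that do: permutations by codes (b, t), scalars by pairs of integers standing for Z[zeta]. A
    matrix identity over Z[zeta] specialises to every field with a root of z^2 + z + 1, so one
    computation serves all k; characteristic zero enters only through the nonvanishing of the
    integers coming from y_top x_top. The explicit module is a homomorphism of D into square
    matrices acting on columns. Simplicity rests on the intertwiner [toV] being onto: a nonzero v =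
    [toV] x has a nonzero coordinate x_j, and some element of D acts on columns as a nonzero
    multiple of coordinate j followed by a ket. A projection delta_h isolates this ket because, for
    these weights, the degree components of M(g, rho) are one-dimensional. The matrices are used
    once more to show that 1 (x) m is not 0. *)

Section SubmoduleTheory.
Variables (R : nzRingType) (V : lmodType R).

Lemma subm0 (U : submodule V) : 0 \in U.
Proof. by case: (subm_closed U). Qed.

Lemma submD (U : submodule V) u v : u \in U -> v \in U -> u + v \in U.
Proof.
by case: (subm_closed U) => _ Ul uU vU; rewrite -[u]scale1r; apply: Ul.
Qed.

Lemma submod_val_inj (U : submodule V) : injective (@submod_val R V U).
Proof. exact: (@val_inj _ _ (submodType U)). Qed.

Lemma quotmod_pi0 (U : submodule V) : quotmod_pi U 0 = 0.
Proof. by apply: (@addrI _ (quotmod_pi U 0)); rewrite -quotmod_piD !addr0. Qed.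

Lemma quotmod_pi_eq0 (U : submodule V) v : (quotmod_pi U v == 0) = (v \in U).
Proof. by rewrite -(quotmod_pi0 U) quotmod_piP subr0. Qed.

End SubmoduleTheory.

Section SimpleModules.
Variables (R : nzRingType) (V : lmodType R).

Lemma zero_submod_closed : GRing.submod_closed (fun v : V => v == 0).
Proof.
split=> [|a v w]; rewrite !unfold_in //= => /eqP-> /eqP->.
by rewrite scaler0 addr0.
Qed.

Lemma full_submod_closed : GRing.submod_closed (fun _ : V => true).
Proof. by []. Qed.

Let full : submodule V := Submodule full_submod_closed.

Hypothesis simpleV : simple_module V.

(** In a simple module the zero submodule is itself maximal, so the radical lies in it. *)
Lemma simple_radical v : v \in radical V -> v = 0.
Proof.
case: simpleV => -[v0 v0P] subV /asboolP /(_ (Submodule zero_submod_closed)) H.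
apply/eqP/H; split=> [/(_ v0)|W _]; last by case: (subV W) => WE; [left|right].
by rewrite [_ \in _](negbTE v0P).
Qed.

(** The socle is generated by submodules, so simplicity has to be moved to V seen as a submodule of
    itself; [simple_socle] then puts every vector in the socle. *)
Lemma simple_full : simple_module (submodType full).
Proof.
case: simpleV => -[v0 v0P] subV.
pose elt v : submodType full := SubmodElt (isT : v \in subm_pred full).
have eltK u : elt (submod_val u) = u by apply: submod_val_inj.
split=> [|U]; first by exists (elt v0); rewrite -val_eqE.
have Wcl : GRing.submod_closed (fun v => elt v \in U).
  split=> [|a v w].
    have e0 : elt 0 = 0 by apply: submod_val_inj.
    by rewrite unfold_in e0 subm0.
  rewrite !unfold_in => vU wU.
  rewrite (_ : elt _ = a *: elt v + elt w); last exact: submod_val_inj.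
  by apply: submD => //; apply: subm_scale.
have UE u : (u \in U) = (submod_val u \in Submodule Wcl).
  by rewrite [RHS]unfold_in /= eltK.
case: (subV (Submodule Wcl)) => WE; [left|right] => u; by rewrite UE WE.
Qed.

Lemma simple_socle v : v \in socle V.
Proof.
by apply/asboolP/submod_gen_in; exists full => //; apply: simple_full.
Qed.

Lemma simple_head_socle :
  isomorphic (quotmod (radical V)) (submodType (socle V)).
Proof.
pose f (q : quotmod (radical V)) : submodType (socle V) :=
  SubmodElt (simple_socle (quotmod_repr q)).
(* Since the radical is 0, representatives are unique; choosing one is therefore inverse to the
   projection, hence linear. *)
have piK : cancel (quotmod_pi (radical V)) (@quotmod_repr _ _ (radical V)).
  move=> v; apply/eqP; rewrite -subr_eq0; apply/eqP/simple_radical.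
  by rewrite -quotmod_piP quotmod_reprK.
have f_lin : linear f.
  move=> a q r; apply: submod_val_inj => /=.
  rewrite -{1}[q]quotmod_reprK -{1}[r]quotmod_reprK.
  by rewrite [a *: _]quotmod_scaleE -quotmod_piD piK.
pose fL := HB.pack_for {linear quotmod (radical V) -> submodType (socle V)} f
  (GRing.isLinear.Build R _ _ *:%R f f_lin).
exists fL; exists (fun u => quotmod_pi _ (submod_val u)) => [q|u] /=.
  exact: quotmod_reprK.
by apply: submod_val_inj => /=; rewrite piK.
Qed.

End SimpleModules.

(** * The universal property of the double *)

Section DrelMorphism.
Variables (k : fieldType) (A B : lalgType k) (f : {rmorphism A -> B}).
Variables (X Y : transp -> A) (G E : 'S_3 -> A).
Hypothesis fZ : forall c a, f (c *: a) = c *: f a.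

Let fE := (rmorphM f, rmorphB f, rmorphD f, rmorph0 f, rmorph1 f, fZ).

Lemma Drel_morph a b : Drel X Y G E a b ->
  Drel (f \o X) (f \o Y) (f \o G) (f \o E) (f a) (f b).
Proof.
have X_E t : f (X t) = (f \o X) t by [].
have Y_E t : f (Y t) = (f \o Y) t by [].
have G_E g : f (G g) = (f \o G) g by [].
have E_E h : f (E h) = (f \o E) h by [].
by case=> *; rewrite ?(raddf_sum, fun_if f, fE) ?(X_E, Y_E, G_E, E_E);
  constructor.
Qed.

(** Each relation between the images is the image of the same relation in A. This carries the
    defining relations from the free algebra to its quotient D. *)
Lemma Drel_reflect : (forall a b, Drel X Y G E a b -> f a = f b) ->
  forall c d, Drel (f \o X) (f \o Y) (f \o G) (f \o E) c d -> c = d.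
Proof.
pose r := (raddf_sum f, fun_if f, fE).
move=> fP c d; case=> [g h||g h||t|i j l ij il jl|t|i j l ij il jl|h g|g t
  |h t|h t|t g|t|i j l ij il jl] /=.
- by have := fP _ _ (Drel_gg X Y G E g h); rewrite !r.
- by have := fP _ _ (Drel_g1 X Y G E); rewrite !r.
- by have := fP _ _ (Drel_dd X Y G E g h); rewrite !r.
- by have := fP _ _ (Drel_d1 X Y G E); rewrite !r.
- by have := fP _ _ (Drel_xx X Y G E t); rewrite !r.
- by have := fP _ _ (Drel_xxx X Y G E ij il jl); rewrite !r.
- by have := fP _ _ (Drel_yy X Y G E t); rewrite !r.
- by have := fP _ _ (Drel_yyy X Y G E ij il jl); rewrite !r.
- by have := fP _ _ (Drel_dg X Y G E h g); rewrite !r.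
- by have := fP _ _ (Drel_gx X Y G E g t); rewrite !r.
- by have := fP _ _ (Drel_dx X Y G E h t); rewrite !r.
- by have := fP _ _ (Drel_dy X Y G E h t); rewrite !r.
- by have := fP _ _ (Drel_yg X Y G E t g); rewrite !r.
- by have := fP _ _ (Drel_yx_same X Y G E t); rewrite !r.
- by have := fP _ _ (Drel_yx_diff X Y G E ij il jl); rewrite !r.
Qed.

End DrelMorphism.

Section Double.
Variable k : fieldType.
Local Notation Dalg := (Dalg k).

Lemma DpiM (a b : freeD k) : Dpi (a * b) = Dpi a * Dpi b.
Proof. by rewrite -DmulE. Qed.

Lemma DpiZ c (a : freeD k) : Dpi (c *: a) = c *: Dpi a.
Proof. by rewrite -DscaleE. Qed.

Fact Dpi_is_zmod_morphism : zmod_morphism (@Dpi k).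
Proof.
by move=> a b; rewrite DpiD -scaleN1r DpiZ scaleN1r.
Qed.

Fact Dpi_is_monoid_morphism : monoid_morphism (@Dpi k).
Proof. by split; [exact: erefl | exact: DpiM]. Qed.

HB.instance Definition _ :=
  GRing.isZmodMorphism.Build (freeD k) Dalg (@Dpi k) Dpi_is_zmod_morphism.
HB.instance Definition _ :=
  GRing.isMonoidMorphism.Build (freeD k) Dalg (@Dpi k) Dpi_is_monoid_morphism.

Lemma DrelP a b :
  Drel (@Dx k) (@Dy k) (@Dg k) (@Dd k) a b -> a = b.
Proof.
apply: (Drel_reflect (f := @Dpi k) DpiZ) => {}a {}b ab.
by apply/Dpi_eqP/Dideal_rel.
Qed.

Lemma freeD_ind (P : freeD k -> Prop) :
  P 1 -> (forall a b, P a -> P b -> P (a + b)) ->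
  (forall a b, P a -> P b -> P (a * b)) -> (forall c a, P a -> P (c *: a)) ->
  (forall s, P << fmu s >>) -> forall a, P a.
Proof.
move=> P1 PD PM PZ Pgen a.
have P0 : P 0 by rewrite -(scale0r 1); apply: PZ.
have Pword (w : seq Dgen) (m : {fmonom Dgen}) : m = w :> seq Dgen -> P << m >>.
  elim: w m => [|s w IHw] m mE.
    by rewrite (_ : m = mone) //; apply/val_inj; rewrite /= mE fm1.
  have [m' m'E] : exists m' : {fmonom Dgen}, m' = w :> seq Dgen.
    by exists (FMonom w).
  rewrite (_ : << m >> = << fmu s >> * << m' >>).
    by apply: PM => //; apply: IHw.
  rewrite [RHS](@fgmulUU _ k) mulr1; congr (<< _ >>).
  by apply/val_inj; rewrite /= fmM fmU mE m'E.
rewrite [a]monalgE; elim/big_rec: _ => // m b _ Pb; apply: PD => //.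
rewrite (_ : << a@_m *g m >> = a@_m *: << m >>).
  by apply: PZ; apply: (Pword m).
by apply/malgP=> m'; rewrite mcoeffZ (@mcoeffU _ k) (@mcoeffU _ k) mulr_natr.
Qed.

Lemma Dalg_ind (P : Dalg -> Prop) :
  P 1 -> (forall a b, P a -> P b -> P (a + b)) ->
  (forall a b, P a -> P b -> P (a * b)) -> (forall c a, P a -> P (c *: a)) ->
  (forall t, P (Dx k t)) -> (forall t, P (Dy k t)) ->
  (forall g, P (Dg k g)) -> (forall h, P (Dd k h)) -> forall a, P a.
Proof.
move=> P1 PD PM PZ Px Py Pg Pd a; rewrite -[a]DreprK.
elim/freeD_ind: (Drepr a) => {a} //.
- by move=> a b Pa Pb; rewrite rmorphD; apply: PD.
- by move=> a b Pa Pb; rewrite rmorphM; apply: PM.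
- by move=> c a Pa; rewrite DpiZ; apply: PZ.
- case=> [[t|t]|[g|h]]; [exact: Px|exact: Py|exact: Pg|exact: Pd].
Qed.

Section Representation.
Variables (A : algType k) (X Y : transp -> A) (G E : 'S_3 -> A).
Hypothesis relA : forall a b, Drel X Y G E a b -> a = b.

Definition gen_val (s : Dgen) : A :=
  match s with
  | inl (inl t) => X t
  | inl (inr t) => Y t
  | inr (inl g) => G g
  | inr (inr h) => E h
  end.

Definition word_val (w : {fmonom Dgen}) : A := \prod_(s <- w) gen_val s.

Lemma word_val_morph : mmorphism word_val.
Proof.
split=> [u v|]; rewrite /word_val; last by rewrite fm1 big_nil.
by rewrite fmM big_cat.
Qed.

HB.instance Definition _ :=
  isMultiplicative.Build {fmonom Dgen} A word_val word_val_morph.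

Definition freeD_val (a : freeD k) : A := mmap (in_alg A) word_val a.

Lemma freeD_valB : {morph freeD_val : a b / a - b}.
Proof. exact: mmapB. Qed.

Lemma freeD_valZ c : {morph freeD_val : a / c *: a}.
Proof. by move=> a; rewrite /freeD_val mmapZ /= mulr_algl. Qed.

Lemma freeD_val_is_multiplicative : multiplicative freeD_val.
Proof.
apply: commr_mmap_is_multiplicative => a w w'.
by rewrite /GRing.comm /= mulr_algl mulr_algr.
Qed.

HB.instance Definition _ :=
  GRing.isAdditive.Build (freeD k) A freeD_val freeD_valB.
HB.instance Definition _ :=
  GRing.isMultiplicative.Build (freeD k) A freeD_val
    freeD_val_is_multiplicative.

Lemma freeD_valU s : freeD_val << fmu s >> = gen_val s.
Proof. by rewrite /freeD_val mmapU /= scale1r mul1r /word_val fmU big_seq1. Qed.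

Lemma freeD_val_Dideal a : Dideal a -> freeD_val a = 0.
Proof.
elim=> [{}a b /(Drel_morph freeD_valZ) ab||{}a b _ a0 _ b0|c {}a _ a0
       |c {}a _ a0].
- suff H c d : Drel (freeD_val \o @fx k) (freeD_val \o @fy k)
      (freeD_val \o @fg k) (freeD_val \o @fd k) c d -> c = d.
    by rewrite rmorphB /= (H _ _ ab) subrr.
  have E1 : freeD_val \o @fx k = X by apply/funext => t; apply: freeD_valU.
  have E2 : freeD_val \o @fy k = Y by apply/funext => t; apply: freeD_valU.
  have E3 : freeD_val \o @fg k = G by apply/funext => t; apply: freeD_valU.
  have E4 : freeD_val \o @fd k = E by apply/funext => t; apply: freeD_valU.
  by rewrite E1 E2 E3 E4; apply: relA.
- exact: rmorph0.
- by rewrite rmorphD /= a0 b0 addr0.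
- by rewrite rmorphM /= a0 mulr0.
- by rewrite rmorphM /= a0 mul0r.
Qed.

Lemma Dalg_universal : exists f : {rmorphism Dalg -> A},
  [/\ forall c a, f (c *: a) = c *: f a, forall t, f (Dx k t) = X t,
      forall t, f (Dy k t) = Y t, forall g, f (Dg k g) = G g
    & forall h, f (Dd k h) = E h].
Proof.
pose f (a : Dalg) : A := freeD_val (Drepr a).
have fE a : f (Dpi a) = freeD_val a.
  apply/eqP; rewrite -subr_eq0 -rmorphB /=; apply/eqP/freeD_val_Dideal/Dpi_eqP.
  by rewrite DreprK.
have fB : zmod_morphism f.
  move=> a b; rewrite -[a]DreprK -[b]DreprK -rmorphB !fE; exact: rmorphB.
have fM : monoid_morphism f.
  split=> [|a b]; first by rewrite (fE 1) rmorph1.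
  rewrite -[a]DreprK -[b]DreprK -rmorphM !fE; exact: rmorphM.
pose fR := HB.pack_for {rmorphism Dalg -> A} f
  (GRing.isZmodMorphism.Build Dalg A f fB)
  (GRing.isMonoidMorphism.Build Dalg A f fM).
exists fR; split=> [c a|t|t|g|h]; try by rewrite [LHS]fE freeD_valU.
suff : f (c *: a) = c *: f a by [].
by rewrite -[a]DreprK -DpiZ !fE freeD_valZ.
Qed.

End Representation.
End Double.

(** * Permutations of three points as codes *)

(* [(b, t)] with [t < 3] stands for the permutation sigma^b tau^t, and [t]
   alone for the transposition sigma tau^t; the product is that of [mul3]. *)
Definition code := (bool * nat)%type.

(** By tau sigma = sigma tau^-1, moving the sigma of b to the left inverts the power of tau in a.
    The truncated [3 - a.2] is the right exponent only for reduced a, whence the hypothesis of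
    [decodeM]. *)
Definition cmul (a b : code) : code :=
  (a.1 (+) b.1, ((if b.1 then 3 - a.2 else a.2) + b.2) %% 3)%N.
Definition cinv (a : code) : code :=
  if a.1 then a else (false, (3 - a.2) %% 3)%N.
Definition cconj (a : code) (u : nat) : nat :=
  (cmul (cmul a (true, u)) (cinv a)).2.

Definition is_code (a : code) : bool := (a.2 < 3)%N.
Definition codes : seq code :=
  [seq (b, t) | b <- [:: false; true], t <- iota 0 3].

Definition encode (g : 'S_3) : code := (odd_perm g, tau_exp g).
Definition decode (a : code) : 'S_3 :=
  if a.1 then mul3 sigma (tau ^+ a.2)%g else (tau ^+ a.2)%g.

Lemma mem_codes a : (a \in codes) = is_code a.
Proof. by case: a => b [|[|[|t]]]; rewrite /is_code; case: b. Qed.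

Lemma encode_code g : is_code (encode g).
Proof. by rewrite /is_code /encode /tau_exp /=; case: pickP. Qed.

Lemma encodeK : cancel encode decode.
Proof. by move=> g; rewrite /decode /= -tau_expP. Qed.

Lemma odd_decode a : odd_perm (decode a) = a.1.
Proof.
case: a => b t; rewrite /decode /mul3 /=.
have oX : odd_perm (tau ^+ t)%g = false.
  by elim: t => [|t IH]; rewrite ?odd_perm1 // expgS odd_permM odd_tau IH.
by case: b => //=; rewrite odd_permM oX odd_tperm.
Qed.

Lemma tauX0 t : (tau ^+ t)%g 0 = t%:R :> 'I_3.
Proof.
elim: t => [|t IH]; first by rewrite perm1.
by rewrite expgSr permM IH permE -natr1.
Qed.

(** The sign recovers b; then tau^t, a translation on Z/3, recovers t as the image of 0. *)
Lemma decode_inj : {in is_code &, injective decode}.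
Proof.
move=> [b t] [c u] /=; rewrite !unfold_in /is_code /= => t3 u3 E.
have bc : b = c by have := congr1 (@odd_perm _) E; rewrite !odd_decode.
have tu : (tau ^+ t)%g = (tau ^+ u)%g.
  by move: E; rewrite /decode /= bc; case: (c) => // /mulIg.
have := congr1 (fun g : 'S_3 => val (g 0)) tu; rewrite !tauX0 bc.
by move: t u t3 u3 {E tu} => [|[|[|?]]] [|[|[|?]]].
Qed.

Lemma decodeK a : is_code a -> encode (decode a) = a.
Proof.
move=> a3; apply: decode_inj => //; rewrite ?encodeK //; exact: encode_code.
Qed.

Lemma tau3 : (tau ^+ 3 = 1)%g.
Proof.
apply/permP => i; rewrite 2!expgS expg1 !permM !permE; apply/val_inj.
by case: i => -[|[|[|]]].
Qed.

Lemma tauJ : (tau ^ sigma = tau^-1)%g.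
Proof.
apply: (mulgI tau); rewrite mulgV; apply/permP => i.
rewrite conjgE tpermV !permM perm1.
by case: i => -[|[|[|]]] // ?; rewrite !permE; apply/val_inj.
Qed.

Lemma decodeM a b : is_code a -> decode (cmul a b) = mul3 (decode a) (decode b).
Proof.
case: a b => a t [b u]; rewrite /is_code /= => t3.
have XE n : (tau ^+ (n %% 3) = tau ^+ n)%g by apply: expg_mod tau3.
have X3 : (tau ^+ (3 - t) = tau ^- t)%g.
  by apply: (mulIg (tau ^+ t)%g); rewrite -expgD subnK ?tau3 ?mulVg // ltnW.
have J : (sigma * tau ^+ t = tau ^- t * sigma)%g.
  by rewrite -expVgn -tauJ -conjXg conjgE -mulgA tpermV -mulgA tperm2 mulg1.
have XD n m : (tau ^+ n * tau ^+ m = tau ^+ m * tau ^+ n)%g.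
  by rewrite -!expgD addnC.
rewrite /cmul /decode /mul3 /=; case: b; case: a => /=; rewrite XE expgD ?X3.
- by rewrite mulgA -(mulgA _ sigma) J !mulgA -!mulgA tperm2 mulg1 -X3 XD.
- by rewrite -!mulgA J -X3 !mulgA XD.
- by rewrite mulgA XD.
- by rewrite XD.
Qed.

Lemma encodeM g h : encode (mul3 g h) = cmul (encode g) (encode h).
Proof.
apply: decode_inj; rewrite ?decodeM ?encodeK //; first exact: encode_code.
- by rewrite /cmul unfold_in /is_code /= ltn_mod.
- exact: encode_code.
Qed.

Lemma encode1 : encode 1%g = (false, 0%N).
Proof. by rewrite -(decodeK (a := (false, 0%N))). Qed.

Lemma encodeV g : encode g^-1%g = cinv (encode g).
Proof.
have a3 := encode_code g; move: (encode g) (encodeK g) a3 => a <- a3.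
have c3 : is_code (cinv a).
  by rewrite /cinv; case: ifP => // _; rewrite /is_code ltn_mod.
have aV : cmul (cinv a) a = (false, 0%N) by move: a a3 {c3} => [[] [|[|[|]]]].
rewrite -[RHS]decodeK //; congr encode; apply/eqP; rewrite eq_invg_mul.
by rewrite -[(_ * _)%g]/(mul3 _ _) -decodeM // aV.
Qed.

Lemma encode_eq g h : (encode g == encode h) = (g == h).
Proof. exact: (can_eq encodeK). Qed.

Definition tcode (t : transp) : nat := tau_exp (val t).

Lemma transp_odd (t : transp) : odd_perm (val t).
Proof.
by case: t => t /= /existsP[i /existsP[j /andP[ij /eqP->]]]; rewrite odd_tperm.
Qed.

Lemma encode_transp t : encode (val t) = (true, tcode t).
Proof. by rewrite /encode transp_odd. Qed.

Lemma tcode_lt t : (tcode t < 3)%N.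
Proof. exact: (encode_code (val t)). Qed.

Lemma tcode_inj : injective tcode.
Proof.
by move=> t u tu; apply/val_inj/(can_inj encodeK); rewrite !encode_transp tu.
Qed.

Lemma tcode_conj g t : tcode (conjT g t) = cconj (encode g) (tcode t).
Proof.
rewrite -[LHS]/(encode (conj3 g (val t))).2.
by rewrite !encodeM encodeV encode_transp.
Qed.

Definition tr_of (u : nat) : transp :=
  match u with
  | 0 => @tr 0 1 isT
  | 1 => @tr 1 2 isT
  | _ => @tr 0 2 isT
  end.

Lemma tr_ofK u : (u < 3)%N -> tcode (tr_of u) = u.
Proof.
move=> u3.
have encE i j (ij : i != j) :
    is_code (true, u) -> tperm i j = decode (true, u) -> tcode (tr ij) = u.
  move=> u3' tE; have := encode_transp (tr ij).
  by rewrite /= tE decodeK // => -[].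
case: u u3 encE => [|[|[|]]] // _ encE; apply: encE => //; rewrite /decode /=.
- by rewrite /mul3 mul1g.
- by rewrite expg1 sigma_tau.
apply/permP => x; rewrite mul3E 1!expgS expg1 !permE /= !permE /=.
by case: x => -[|[|[|]]] // ?; apply/val_inj.
Qed.

Lemma tcodeK : cancel tcode tr_of.
Proof. by move=> t; apply: tcode_inj; rewrite tr_ofK ?tcode_lt. Qed.

(** Modulo 3, sigma is i |-> 1 - i, so sigma tau^u is i |-> 1 - u - i. It exchanges i and j when u =
    1 - (i + j) = 2(i + j) + 1. *)
Lemma tcode_tr (i j : 'I_3) (ij : i != j) :
  tcode (tr ij) = ((i + j).*2.+1 %% 3)%N.
Proof.
have trE (a b c d : 'I_3) (ab : a != b) (cd : c != d) :
    (a == c) && (b == d) || (a == d) && (b == c) ->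
    tcode (tr ab) = tcode (tr cd).
  case/orP => /andP[/eqP ac /eqP bd]; congr tcode; apply/val_inj => /=.
    by rewrite ac bd.
  by rewrite ac bd tpermC.
rewrite -[RHS]tr_ofK ?ltn_mod //.
by case: i j ij => -[|[|[|//]]] ? [[|[|[|//]]] ?] // ij; apply: trE.
Qed.

Lemma encode_tperm (i j : 'I_3) : i != j ->
  encode (tperm i j) = (true, (i + j).*2.+1 %% 3)%N.
Proof. by move=> ij; rewrite -tcode_tr -encode_transp. Qed.

(** * Explicit modules *)

(* [(a, b)] stands for a + b zeta, where zeta^2 + zeta + 1 = 0. *)
Definition coef := (int * int)%type.
Definition coef_add (x y : coef) : coef := (x.1 + y.1, x.2 + y.2).
Definition coef_mul (x y : coef) : coef :=
  (x.1 * y.1 - x.2 * y.2, x.1 * y.2 + x.2 * y.1 - x.2 * y.2).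
Definition coef_sign (b : bool) : coef := (if b then -1 else 1, 0).

(* Sparse vectors, with repeated indices allowed, and matrices given by their
   columns. *)
Definition vec := seq (nat * coef).
Definition op := nat -> vec.

Definition vcoef (v : vec) (i : nat) : coef :=
  foldr (fun p c => if p.1 == i then coef_add p.2 c else c) (0, 0) v.
Definition vscale (c : coef) (v : vec) : vec :=
  [seq (p.1, coef_mul c p.2) | p <- v].
Definition vbind (f : op) (v : vec) : vec :=
  foldr (fun p w => vscale p.2 (f p.1) ++ w) [::] v.

Definition opM (f g : op) : op := fun j => vbind f (g j).
Definition opD (f g : op) : op := fun j => f j ++ g j.
Definition opZ (c : coef) (f : op) : op := fun j => vscale c (f j).
Definition op0 : op := fun _ => [::].
(** Only rows listed in one of the two columns are compared; in all others both entries are 0. *)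
Definition op_eq (n : nat) (f g : op) : bool :=
  all (fun j => let u := f j in let v := g j in
    all (fun p => vcoef u p.1 == vcoef v p.1) (u ++ v)) (iota 0 n).

(* A basis of B(V) in monomials, closed under taking tails; the letter t is
   x_(sigma tau^t). *)
Definition words : seq (seq nat) :=
  [:: [::]; [:: 0]; [:: 1]; [:: 2]; [:: 0; 1]; [:: 0; 2]; [:: 1; 0]; [:: 1; 2];
      [:: 0; 1; 0]; [:: 0; 1; 2]; [:: 1; 0; 2]; [:: 0; 1; 0; 2]]%N.

(* The left multiplication by x_u on this basis: [xtable u i] lists the terms
   of x_u times the i-th word, as a sign bit and the index of a word. *)
Definition xtable (u i : nat) : seq (bool * nat) :=
  nth [::] (nth [::]
    [:: [:: [:: (false, 1)]; [::]; [:: (false, 4)]; [:: (false, 5)];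
            [::]; [::]; [:: (false, 8)]; [:: (false, 9)];
            [::]; [::]; [:: (false, 11)]; [::]];
        [:: [:: (false, 2)]; [:: (false, 6)]; [::]; [:: (false, 7)];
            [:: (false, 8)]; [:: (false, 10)]; [::]; [::];
            [::]; [:: (false, 11)]; [::]; [::]];
        [:: [:: (false, 3)]; [:: (true, 4); (true, 7)];
            [:: (true, 5); (true, 6)]; [::];
            [:: (false, 10)]; [:: (true, 9)]; [:: (false, 9)]; [:: (true, 10)];
            [:: (true, 11)]; [::]; [::]; [::]]] u) i.

(* A simple module over the double of the group algebra, with basis |0>, ...,
   |ket_max>: |m> has degree [ket_deg m], and g|m> = c|l> for
   [ket_act g m = (l, c)]. In the induced module, the basis vector number
   12 m + i is the i-th word applied to |m>. *)
Record model := Model {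
  ket_max : nat;
  ket_deg : nat -> code;
  ket_act : code -> nat -> nat * coef
}.

Section Model.
Variable M : model.

Definition model_size : nat := ((ket_max M) * 12 + 11).+1.

(** Empty columns past the size make [opM] agree with the matrix product: an out-of-range index in a
    sparse vector is invisible in the column vector and must contribute nothing. *)
Definition cut (f : op) : op :=
  fun j => if (j < model_size)%N then f j else [::].

Definition op1 : op := cut (fun j => [:: (j, (1, 0))]).

Definition xop (u : nat) : op := cut (fun j =>
  [seq ((12 * (j %/ 12) + p.2)%N, coef_sign p.1) | p <- xtable u (j %% 12)]).

Fixpoint gact (a : code) (w : seq nat) (m : nat) : vec :=
  if w is u :: w' then
    vscale (coef_sign a.1) (vbind (xop (cconj a u)) (gact a w' m))
  else [:: ((12 * (ket_act M a m).1)%N, (ket_act M a m).2)].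

(** By delta_h x_t = x_t delta_(th), each letter multiplies the degree by its transposition on the
    left. *)
Definition wdeg (w : seq nat) (m : nat) : code :=
  foldr (fun u => cmul (true, u)) (ket_deg M m) w.

(* The recursion moves y_s past x_u:
   y_s x_u = - x_u y_(usu) + [s = u] + u (delta_s - delta_(su)). *)
Fixpoint yact (s : nat) (w : seq nat) (m : nat) : vec :=
  if w is u :: w' then
    vscale (coef_sign true) (vbind (xop u) (yact (cconj (true, u) s) w' m))
    ++ (if s == u then [:: ((12 * m + index w' words)%N, (1, 0))] else [::])
    ++ (if wdeg w' m == (true, s) then gact (true, u) w' m else [::])
    ++ (if wdeg w' m == cmul (true, s) (true, u)
        then vscale (coef_sign true) (gact (true, u) w' m) else [::])
  else [::].

Definition word (i : nat) : seq nat := nth [::] words i.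

Definition gop (a : code) : op :=
  cut (fun j => gact a (word (j %% 12)) (j %/ 12)).
Definition dop (a : code) : op := cut (fun j =>
  if wdeg (word (j %% 12)) (j %/ 12) == a then [:: (j, (1, 0))] else [::]).
Definition yop (s : nat) : op :=
  cut (fun j => yact s (word (j %% 12)) (j %/ 12)).

Let eqM := op_eq model_size.
(* the code of the transposition of i and j, see [tcode_tr] *)
Let swap i j := ((i + j).*2.+1 %% 3)%N.

Definition check_gd : bool :=
  [&& all (fun a => all (fun b =>
        eqM (opM (gop a) (gop b)) (gop (cmul a b))) codes) codes,
      eqM (gop (false, 0%N)) op1,
      all (fun a => all (fun b => eqM (opM (dop a) (dop b))
         (if a == b then dop a else op0)) codes) codes
    & all (fun a => all (fun b => eqM (opM (dop b) (gop a))
         (opM (gop a) (dop (cmul (cmul (cinv a) b) a)))) codes) codes].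

Definition check_quad (z : nat -> op) : bool :=
  all (fun u => eqM (opM (z u) (z u)) op0) (iota 0 3) &&
  all (fun i => all (fun j => all (fun l =>
    [&& i != j, i != l & j != l] ==>
    eqM (opD (opD (opM (z (swap i j)) (z (swap i l)))
                  (opM (z (swap j l)) (z (swap i j))))
             (opM (z (swap i l)) (z (swap j l)))) op0)
   (iota 0 3)) (iota 0 3)) (iota 0 3).

Definition check_cross : bool :=
  all (fun a => all (fun u =>
    [&& eqM (opM (gop a) (xop u))
          (opZ (coef_sign a.1) (opM (xop (cconj a u)) (gop a))),
        eqM (opM (dop a) (xop u)) (opM (xop u) (dop (cmul (true, u) a))),
        eqM (opM (dop a) (yop u)) (opM (yop u) (dop (cmul (true, u) a)))
      & eqM (opM (yop u) (gop a))
          (opZ (coef_sign a.1) (opM (gop a) (yop (cconj (cinv a) u))))])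
   (iota 0 3)) codes.

Definition check_yx : bool :=
  all (fun u =>
    eqM (opD (opM (yop u) (xop u)) (opM (xop u) (yop u)))
      (opD op1 (opM (gop (true, u)) (opD (dop (true, u))
         (opZ (coef_sign true) (dop (false, 0%N)))))))
    (iota 0 3) &&
  all (fun i => all (fun j => all (fun l =>
    [&& i != j, i != l & j != l] ==>
    eqM (opD (opM (yop (swap i l)) (xop (swap i j)))
             (opM (xop (swap i j)) (yop (swap j l))))
      (opM (gop (true, swap i j)) (opD (dop (true, swap i l))
         (opZ (coef_sign true)
            (dop (cmul (true, swap i l) (true, swap i j)))))))
   (iota 0 3)) (iota 0 3)) (iota 0 3).
End Model.

Definition model_e_minus : model :=
  Model 0 (fun _ => (false, 0%N)) (fun a _ => (0%N, coef_sign a.1)).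
Definition model_sigma_plus : model :=
  Model 2 (fun m => (true, m)) (fun a m => (cconj a m, (1, 0))).
(** The case l = 1. The list holds 1, zeta and zeta^2 = -1 - zeta; ket 1 is |tau^-1>, of degree
    tau^2, where the exponent of zeta changes sign. *)
Definition model_tau : model :=
  Model 1 (fun m => (false, m.+1))
    (fun a m => ((if a.1 then 1 - m else m)%N,
      nth (1, 0) [:: (1, 0); (0, 1); (-1, -1)]
        ((if m == 0 then a.2 else (3 - a.2)) %% 3)%N)).

(* Dual to [words]: if the i-th and l-th words have the same degree, then the
   i-th dual word times the l-th word is 0 for i != l, and the top word up to
   sign for i = l. *)
Definition dual_words : seq (seq nat) :=
  [:: [:: 0; 1; 0; 2]; [:: 2; 0; 1]; [:: 2; 1; 0]; [:: 0; 1; 0];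
      [:: 2; 1]; [:: 0; 1]; [:: 2; 0]; [:: 1; 0]; [:: 2]; [:: 1]; [:: 0]; [::]]%N.

(* A multiple of the matrix unit from the j-th basis vector to |j / 12>. *)
Definition dual_op (M : model) (j : nat) : op :=
  opM (dop M (ket_deg M (j %/ 12)))
    (foldr (fun u => opM (yop M u))
      (foldr (fun u => opM (xop M u)) (op1 M) (nth [::] dual_words (j %% 12)))
      [:: 0; 1; 0; 2]%N).

(** Words of another length than the j-th are killed: longer ones overshoot the top degree, and for
    shorter ones y_top lowers below degree 0. Words of the same length are separated by duality, and
    kets by the projection, their degrees being distinct. Requiring [c.2 == 0] makes c an integer,
    so that characteristic zero keeps it nonzero in k. *)
Definition check_dual (M : model) : bool :=
  all (fun j => let f := dual_op M j in
    let c := vcoef (f j) (12 * (j %/ 12)) in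
    [&& c.1 != 0, c.2 == 0 & op_eq (model_size M) f
      (fun l => if l == j then [:: ((12 * (j %/ 12))%N, c)] else [::])])
  (iota 0 (model_size M)).

(** Used to pass from one ket in a submodule to all of them; the coefficient is exactly 1, so
    nothing has to be inverted. *)
Definition check_trans (M : model) : bool :=
  let kets := iota 0 (ket_max M).+1 in
  all (fun m => all (fun l =>
    has (fun a => ket_act M a m == (l, (1, 0))) codes) kets) kets.

Definition check_act (M : model) : bool :=
  all (fun m => is_code (ket_deg M m) &&
    all (fun a => (ket_act M a m).1 < (ket_max M).+1)%N codes)
  (iota 0 (ket_max M).+1).

Definition check (M : model) : bool :=
  [&& [&& check_gd M, check_quad M (xop M), check_quad M (yop M),
          check_cross M & check_yx M],
      check_dual M, check_trans M & check_act M].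

Lemma check_e_minus : check model_e_minus.
Proof. by vm_compute. Qed.

Lemma check_sigma_plus : check model_sigma_plus.
Proof. by vm_compute. Qed.

Lemma check_tau : check model_tau.
Proof. by vm_compute. Qed.

(** * Evaluation of the integer tables in a field *)

Section Semantics.
Variables (k : fieldType) (zeta : k).
Hypothesis zetaE : zeta ^+ 2 + zeta + 1 = 0.

Definition cval (c : coef) : k := c.1%:~R + c.2%:~R * zeta.

Lemma cvalD c d : cval (coef_add c d) = cval c + cval d.
Proof. by rewrite /cval /= !rmorphD mulrDl addrACA. Qed.

Lemma cvalM c d : cval (coef_mul c d) = cval c * cval d.
Proof.
case: c d => [a b] [c d]; rewrite /cval /= !(rmorphB, rmorphD, rmorphM) /=.
move: (a%:~R) (b%:~R) (c%:~R) (d%:~R) => {}a {}b {}c {}d.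
(* The two sides differ by - b d (zeta^2 + zeta + 1). *)
apply/eqP; rewrite -subr_eq0 -(mulr0 (- (b * d))) -zetaE; apply/eqP; ring.
Qed.

Lemma cval_sign b : cval (coef_sign b) = (-1) ^+ b.
Proof. by case: b; rewrite /cval mul0r addr0. Qed.

Section Operators.
Variable n : nat.
Local Notation N := 'cV[k]_n.+1.

Definition vval (v : vec) : N := \col_i cval (vcoef v i).
Definition opval (f : op) : 'M[k]_n.+1 := \matrix_(i, j) cval (vcoef (f j) i).

Lemma cval0 : cval (0, 0) = 0.
Proof. by rewrite /cval mul0r addr0. Qed.

Lemma vcoef_cat u v i : vcoef (u ++ v) i = coef_add (vcoef u i) (vcoef v i).
Proof.
have add0 c : c = coef_add (0, 0) c.
  by case: c => c d; rewrite /coef_add /= !add0r.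
elim: u => [|p u /= ->]; first exact: add0.
case: ifP => // _.
by rewrite /coef_add /= !addrA.
Qed.

Lemma cval_scale c v i :
  cval (vcoef (vscale c v) i) = cval c * cval (vcoef v i).
Proof.
elim: v => /= [|p v IH]; first by rewrite cval0 mulr0.
case: ifP => _; last exact: IH.
by rewrite cvalD cvalM IH -mulrDr -cvalD.
Qed.

Lemma vval_nil : vval [::] = 0.
Proof. by apply/colP => i; rewrite !mxE cval0. Qed.

Lemma vval_cat u v : vval (u ++ v) = vval u + vval v.
Proof. by apply/colP => i; rewrite !mxE vcoef_cat cvalD. Qed.

Lemma vval_scale c v : vval (vscale c v) = cval c *: vval v.
Proof. by apply/colP => i; rewrite !mxE cval_scale. Qed.

Lemma vval_cons j c v :
  vval ((j, c) :: v) = cval c *: vval [:: (j, (1, 0))] + vval v.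
Proof.
rewrite -[(j, c) :: v]/([:: (j, c)] ++ v) vval_cat -vval_scale.
congr (vval [:: (j, _)] + _).
by case: c => a b; rewrite /coef_mul /= !(mulr1, mulr0, subr0, add0r).
Qed.

Definition supported (f : op) : Prop := forall j, (n < j)%N -> f j = [::].

Lemma opval_col f j : (j < n.+1)%N ->
  opval f *m vval [:: (j, (1, 0))] = vval (f j).
Proof.
move=> jn; apply/colP => i.
rewrite !mxE (bigD1 (Ordinal jn)) //= big1 => [|l lj].
  by rewrite !mxE /= eqxx /coef_add /= !addr0 {2}/cval /= mul0r addr0 mulr1.
rewrite !mxE /= ifF ?cval0 ?mulr0 //.
by apply: contraNF lj => /eqP jl; apply/eqP/val_inj.
Qed.

Lemma opval_vec f v : supported f -> opval f *m vval v = vval (vbind f v).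
Proof.
move=> sf; elim: v => [|[j c] v IH]; first by rewrite vval_nil mulmx0.
rewrite vval_cons mulmxDr -scalemxAr /= vval_cat vval_scale IH.
congr (_ *: _ + _).
have [jn|nj] := ltnP j n.+1; first exact: opval_col.
rewrite sf // vval_nil (_ : vval _ = 0) ?mulmx0 //.
apply/colP => i; rewrite !mxE /=.
by rewrite ifF ?cval0 //; apply: contraTF nj => /eqP->; rewrite -leqNgt -ltnS.
Qed.

Lemma opvalM f g : supported f -> opval f *m opval g = opval (opM f g).
Proof.
move=> sf; apply/matrixP => i j.
have /colP/(_ i) := opval_vec (g j) sf.
by rewrite !mxE => <-; apply: eq_bigr => l _; rewrite !mxE.
Qed.

Lemma opvalD f g : opval f + opval g = opval (opD f g).
Proof. by apply/matrixP => i j; rewrite !mxE vcoef_cat cvalD. Qed.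

Lemma opvalZ c f : cval c *: opval f = opval (opZ c f).
Proof. by apply/matrixP => i j; rewrite !mxE cval_scale. Qed.

Lemma opval0 : opval op0 = 0.
Proof. by apply/matrixP => i j; rewrite !mxE cval0. Qed.

Lemma op_eqP f g : op_eq n.+1 f g -> opval f = opval g.
Proof.
have vcoef0 v i : all (fun p => p.1 != i) v -> vcoef v i = (0, 0).
  by elim: v => //= p v IH /andP[/negbTE-> /IH].
move=> /allP fg; apply/matrixP => i j; rewrite !mxE; congr cval.
have /allP fgj : all (fun p => vcoef (f j) p.1 == vcoef (g j) p.1) (f j ++ g j).
  by apply: fg; rewrite mem_iota /= add0n ltn_ord.
have [/hasP[p pfg /eqP <-]|] :=
  boolP (has (fun p => p.1 == i :> nat) (f j ++ g j)).
  exact/eqP/fgj.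
by rewrite -all_predC all_cat => /andP[fi gi]; rewrite !vcoef0.
Qed.

End Operators.

(** * The matrices satisfy the relations of D *)

Section Representation.
Variable M : model.
Hypothesis checkM : check M.

Local Notation n := (ket_max M * 12 + 11)%N.

Definition Xmx (t : transp) : 'M[k]_n.+1 := opval n (xop M (tcode t)).
Definition Ymx (t : transp) : 'M[k]_n.+1 := opval n (yop M (tcode t)).
Definition Gmx (g : 'S_3) : 'M[k]_n.+1 := opval n (gop M (encode g)).
Definition Emx (h : 'S_3) : 'M[k]_n.+1 := opval n (dop M (encode h)).

Lemma cut_supported f : supported n (cut M f).
Proof. by move=> j nj; rewrite /cut /model_size ltnNge -ltnS ltnS nj. Qed.

Let tsup u : supported n (xop M u) := cut_supported _.
Let ysup u : supported n (yop M u) := cut_supported _.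
Let gsup a : supported n (gop M a) := cut_supported _.
Let dsup a : supported n (dop M a) := cut_supported _.

Lemma opval1 : opval n (op1 M) = 1.
Proof.
apply/matrixP => i j; rewrite !mxE /op1 /cut ltn_ord /= -val_eqE /= eq_sym.
by case: eqP => _; rewrite ?cval0 //= /cval /= mul0r addr0.
Qed.

Lemma encode_mem g : encode g \in codes.
Proof. by rewrite mem_codes encode_code. Qed.

Lemma tcode_mem t : tcode t \in iota 0 3.
Proof. by rewrite mem_iota tcode_lt. Qed.

Lemma ord3_mem (i : 'I_3) : val i \in iota 0 3.
Proof. by rewrite mem_iota ltn_ord. Qed.

Lemma ltn_div_model j : (j %/ 12 < (ket_max M).+1)%N = (j < n.+1)%N.
Proof. by rewrite ltn_divLR // mulSn addnC addnS. Qed.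

(** Every basis vector is homogeneous, so exactly one delta_h fixes it and the others kill it. The
    degree must be a reduced code for such an h to be found, which [check_act] ensures for the
    kets. *)
Lemma sum_Emx : \sum_h Emx h = 1.
Proof.
rewrite -opval1; apply/matrixP => i j; rewrite summxE.
pose a := wdeg M (word (j %% 12)) (j %/ 12).
have a3 : is_code a.
  have jm : (j %/ 12 < (ket_max M).+1)%N.
    by rewrite ltn_div_model.
  rewrite /a; case: (word _) => [|u w] /=; last by rewrite /is_code ltn_mod.
  have /and4P[_ _ _ /allP/(_ (j %/ 12)%N)] := checkM.
  by rewrite mem_iota add0n => /(_ jm) /andP[].
rewrite (bigD1 (decode a)) //= big1 => [|h ha];
  rewrite !mxE /dop /cut ltn_ord -/a.
  by rewrite decodeK // eqxx addr0 /op1 /cut ltn_ord.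
by rewrite ifF ?cval0 //; apply: contraNF ha => /eqP ->; rewrite encodeK.
Qed.

Lemma quad_rel (z : nat -> op) :
  (forall u, supported n (z u)) -> check_quad M z ->
  let Z t := opval n (z (tcode t)) in
  (forall t, Z t *m Z t = 0) /\
  (forall i j l (ij : i != j) (il : i != l) (jl : j != l),
     Z (tr ij) *m Z (tr il) + Z (tr jl) *m Z (tr ij) + Z (tr il) *m Z (tr jl)
     = 0).
Proof.
move=> zs /andP[/allP z2 /allP z3] Z; split=> [t|i j l ij il jl].
  by rewrite /Z opvalM // -opval0; apply/op_eqP/z2/tcode_mem.
have /allP/(_ _ (ord3_mem j))/allP/(_ _ (ord3_mem l)) := z3 _ (ord3_mem i).
rewrite !val_eqE ij il jl /= => /op_eqP zE.
by rewrite /Z !tcode_tr !opvalM // !opvalD -opval0 -zE.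
Qed.

Lemma model_rel a b : Drel Xmx Ymx Gmx Emx a b -> a = b.
Proof.
have /and4P[/and5P[/and4P[gg g1 dd dg] xx yy cross yx] _ _ _] := checkM.
have /andP[yx_same yx_diff] := yx.
have [x2 x3] := quad_rel tsup xx; have [y2 y3] := quad_rel ysup yy.
have all2 (P : code -> code -> bool) a' b' :
    all (fun a => all (P a) codes) codes -> P (encode a') (encode b').
  by move=> /allP/(_ _ (encode_mem a'))/allP/(_ _ (encode_mem b')).
have cr g t := allP (allP cross _ (encode_mem g)) _ (tcode_mem t).
case=> [g h||g h||t|i j l ij il jl|t|i j l ij il jl|h g|g t|h t|h t
  |t g|t|i j l ij il jl] //; rewrite /GRing.mul /= /Xmx /Ymx /Gmx /Emx.
- by rewrite opvalM // encodeM; apply: op_eqP (all2 _ _ _ gg).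
- by rewrite encode1 -opval1; apply: op_eqP.
- rewrite opvalM // (op_eqP (all2 _ _ _ dd)) encode_eq.
  by case: eqP => // _; rewrite opval0.
- exact: sum_Emx.
- exact: x2.
- exact: x3.
- exact: y2.
- exact: y3.
- by rewrite !opvalM // (op_eqP (all2 _ g h dg)) !encodeM encodeV.
- have /and4P[H _ _ _] := cr g t.
  by rewrite !opvalM // (op_eqP H) -opvalZ cval_sign tcode_conj.
- have /and4P[_ H _ _] := cr h t.
  by rewrite !opvalM // (op_eqP H) encodeM encode_transp.
- have /and4P[_ _ H _] := cr h t.
  by rewrite !opvalM // (op_eqP H) encodeM encode_transp.
- have /and4P[_ _ _ H] := cr g t.
  by rewrite !opvalM // (op_eqP H) -opvalZ cval_sign tcode_conj encodeV.
- have sN f : - opval n f = opval n (opZ (coef_sign true) f).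
    by rewrite -opvalZ cval_sign scaleN1r.
  rewrite encode1 encode_transp sN -opval1 !(opvalM, opvalD) //.
  exact/op_eqP/(allP yx_same)/tcode_mem.
have /allP/(_ _ (ord3_mem j))/allP/(_ _ (ord3_mem l)) :=
  allP yx_diff _ (ord3_mem i).
rewrite !val_eqE ij il jl /= => /op_eqP yxE.
have sN f : - opval n f = opval n (opZ (coef_sign true) f).
  by rewrite -opvalZ cval_sign scaleN1r.
by rewrite encodeM !encode_tperm // sN !tcode_tr !(opvalM, opvalD).
Qed.

End Representation.
End Semantics.

(** * The Fomin-Kirillov relations *)

Lemma conj3_id (t : transp) : conjT (val t) t = t.
Proof. by apply/val_inj; rewrite /= /conj3 /mul3 mulgA mulVg mul1g. Qed.

Lemma mul3_transp (t : transp) : mul3 (val t) (val t) = 1%g.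
Proof.
by case: t => t /= /existsP[i /existsP[j /andP[ij /eqP->]]]; exact: tperm2.
Qed.

(** * Moving y past x *)

Section CrossRelation.
Variables (k : fieldType) (A : lalgType k).
Variables (X Y : transp -> A) (G E : 'S_3 -> A).
Hypothesis relA : forall a b, Drel X Y G E a b -> a = b.

Lemma transp_pairs (s t : transp) : s != t -> exists i j l : 'I_3,
  exists (ij : i != j) (il : i != l) (jl : j != l),
    [/\ t = tr ij, s = tr il & conjT (val t) s = tr jl].
Proof.
move=> st; suff [i [j [l /and4P[ij il jl /andP[/eqP tE /eqP sE]]]]] :
    exists i j l : 'I_3, [&& i != j, i != l, j != l,
      tcode t == ((i + j).*2.+1 %% 3)%N & tcode s == ((i + l).*2.+1 %% 3)%N].
  exists i, j, l, ij, il, jl.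
  have tE' : t = tr ij by apply: tcode_inj; rewrite tcode_tr.
  have sE' : s = tr il by apply: tcode_inj; rewrite tcode_tr.
  split=> //; apply/val_inj; rewrite tE' sE' /= /conj3 /mul3.
  by rewrite -conjgE tpermJ tpermL tpermD // eq_sym.
have {}st : tcode s != tcode t by apply: contra st => /eqP/tcode_inj->.
have := tcode_lt s; have := tcode_lt t; move: st.
case: (tcode s) (tcode t) => [|[|[|//]]] [|[|[|//]]] // _ _ _.
- by exists 1, 2, 0.
- by exists 0, 2, 1.
- by exists 1, 0, 2.
- by exists 2, 0, 1.
- by exists 0, 1, 2.
- by exists 2, 1, 0.
Qed.

(** One rule for both cross relations: for s = t the conjugate of s is s and st = e. It is the rule
    behind the recursion of [yact]. *)
Lemma Drel_yx s t : Y s * X t =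
  G (val t) * (E (val s) - E (mul3 (val s) (val t))) + (s == t)%:R
  - X t * Y (conjT (val t) s).
Proof.
have [->|st] := eqVneq s t.
  rewrite conj3_id mul3_transp addrC; apply/eqP; rewrite eq_sym addrC subr_eq.
  by rewrite (relA (Drel_yx_same X Y G E t)) addrC.
have [i [j [l [ij [il [jl [-> -> /= ->]]]]]]] := transp_pairs st.
apply/eqP; rewrite eq_sym subr_eq addr0.
by rewrite (relA (Drel_yx_diff X Y G E ij il jl)).
Qed.

End CrossRelation.

(** * Normal forms of words in B(V) *)

Section FominKirillov.
Variables (W : zmodType) (x : nat -> W -> W).
Hypotheses (xB : forall u, {morph x u : v w / v - w})
  (xx : forall u v, x u (x u v) = 0)
  (x01 : forall v, x 0%N (x 1%N v) + x 2%N (x 0%N v) + x 1%N (x 2%N v) = 0)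
  (x10 : forall v, x 1%N (x 0%N v) + x 2%N (x 1%N v) + x 0%N (x 2%N v) = 0).

Definition wact (w : seq nat) (v : W) : W := foldr x v w.

(** The quadratic relations eliminate 20 and 21, and they imply the braid relation, which eliminates
    101. The words avoiding these and 00, 11, 22 are exactly the twelve in [words]: a 2 can only
    come last, after one of the six alternating words in 0 and 1 without 101. *)
Lemma xtableP u i v : (u < 3)%N -> (i < 12)%N ->
  x u (wact (word i) v) =
  \sum_(p <- xtable u i)
     (if p.1 then - wact (word p.2) v else wact (word p.2) v).
Proof.
have x0 w : x w 0 = 0 by have := xB w 0 0; rewrite !subrr.
have xN w a : x w (- a) = - x w a by rewrite -sub0r xB x0 sub0r.
have x20 w : x 2%N (x 0%N w) = - x 0%N (x 1%N w) - x 1%N (x 2%N w).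
  by apply/eqP; rewrite -subr_eq0 opprD !opprK addrCA addrA x01.
have x21 w : x 2%N (x 1%N w) = - x 1%N (x 0%N w) - x 0%N (x 2%N w).
  by apply/eqP; rewrite -subr_eq0 opprD !opprK addrCA addrA x10.
(* from x_2 x_0 x_0 = 0 *)
have braid w : x 1%N (x 0%N (x 1%N w)) = x 0%N (x 1%N (x 0%N w)).
  have := x20 (x 0%N w); rewrite xx x0 x20 xB xN xx subr0 opprK => /esym/eqP.
  by rewrite addrC subr_eq0 => /eqP.
pose r := (xx, x20, x21, braid, xB, xN, x0, addr0, add0r, oppr0, opprK).
case: u => [|[|[|//]]] _.
all: case: i => [|[|[|[|[|[|[|[|[|[|[|[|//]]]]]]]]]]]] _.
all: rewrite /wact /word /=.
all: rewrite !(big_cons, big_nil) /= ?addr0 ?r //.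
all: by rewrite addrC.
Qed.

End FominKirillov.

Lemma Dx_quad (k : fieldType) (W : lmodType (Dalg k)) i j l
    (ij : i != j) (il : i != l) (jl : j != l) u v w (x : W) :
  tcode (tr ij) = u -> tcode (tr il) = v -> tcode (tr jl) = w ->
  Dx k (tr_of u) *: (Dx k (tr_of v) *: x)
  + Dx k (tr_of w) *: (Dx k (tr_of u) *: x)
  + Dx k (tr_of v) *: (Dx k (tr_of w) *: x) = 0.
Proof.
move=> <- <- <-; rewrite !tcodeK !scalerA -!scalerDl.
by rewrite (DrelP (Drel_xxx _ _ _ _ ij il jl)) scale0r.
Qed.

(** * Verma modules *)

(* A constant of its own, so that rewriting with [scalerA] does not look into
   the scalar. *)
Definition Dscal (k : fieldType) (c : k) : Dalg k := c%:A.

Lemma Dscal_mul (k : fieldType) (c d : k) : Dscal (c * d) = Dscal c * Dscal d.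
Proof. by rewrite /Dscal -scalerAl mul1r scalerA. Qed.

Lemma Dscal_comm (k : fieldType) (c : k) (a : Dalg k) :
  Dscal c * a = a * Dscal c.
Proof. by rewrite /Dscal -scalerAl -scalerAr mul1r mulr1. Qed.

Lemma Dscal0 (k : fieldType) : Dscal (0 : k) = 0.
Proof. exact: scale0r. Qed.

Lemma Dscal1 (k : fieldType) : Dscal (1 : k) = 1.
Proof. exact: scale1r. Qed.

Lemma DscalB (k : fieldType) (c d : k) : Dscal (c - d) = Dscal c - Dscal d.
Proof. exact: scalerBl. Qed.

Lemma Dscal_scale (k : fieldType) (W : lmodType (Dalg k)) (c : k) a (v : W) :
  (c *: a) *: v = Dscal c *: (a *: v).
Proof. by rewrite scalerA /Dscal -scalerAl mul1r. Qed.

Lemma cross_scale (R : nzRingType) (W : lmodType R) (a b c d e f : R) (v : W) :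
  (a * (b - c) + d - e * f) *: v =
  a *: (b *: v - c *: v) + d *: v - e *: (f *: v).
Proof. by rewrite scalerBl scalerDl -!scalerA scalerBl. Qed.

Section VermaTheory.
Variables (k : fieldType) (V : DS3_module k).
Local Notation Dalg := (Dalg k).

(** The vector 1 (x) m. *)
Definition vket (m : V) : Verma V :=
  quotmod_pi (span_submod (@Verma_rel k V)) << m >>.

Lemma vketD m m' : vket (m + m') = vket m + vket m'.
Proof.
apply/eqP; rewrite -quotmod_piD quotmod_piP opprD addrA.
by apply/asboolP/submod_gen_in/Verma_add.
Qed.

Lemma vket_act b f m : Dge0_act b f -> b *: vket m = vket (f m).
Proof.
move=> bf; apply/eqP; rewrite [_ *: _]quotmod_scaleE quotmod_piP.
by apply/asboolP/submod_gen_in/Verma_bal.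
Qed.

Lemma vketZ c m : vket (c *: m) = Dscal c *: vket m.
Proof. by rewrite (vket_act m (Dge0_act_Z c (Dge0_act_1 V))). Qed.

Lemma vket_g g m : Dg k g *: vket m = vket (DS3_g g m).
Proof. exact: vket_act (Dge0_act_g V g). Qed.

Lemma vket_d h m : Dd k h *: vket m = vket (DS3_d h m).
Proof. exact: vket_act (Dge0_act_d V h). Qed.

Lemma vket0 : vket 0 = 0.
Proof. by apply: (addIr (vket 0)); rewrite -vketD !add0r. Qed.

Lemma vket_y t m : Dy k t *: vket m = 0.
Proof. by rewrite (vket_act m (Dge0_act_y V t)) vket0. Qed.

Lemma vket_sum (I : Type) (r : seq I) (f : I -> V) :
  vket (\sum_(i <- r) f i) = \sum_(i <- r) vket (f i).
Proof. exact: (big_morph vket vketD vket0). Qed.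

Lemma vket_gen (U : submodule (Verma V)) :
  (forall m, vket m \in U) -> U =i predT.
Proof.
move=> Um v; rewrite [RHS]inE -[v]quotmod_reprK.
rewrite [quotmod_repr v]monalgE.
elim/big_rec: _ => [|m u _ Uu]; first by rewrite quotmod_pi0 subm0.
rewrite quotmod_piD; apply: submD => //.
have -> : << (quotmod_repr v)@_m *g m >> =
    (quotmod_repr v)@_m *: << m >> :> {malg Dalg[V]}.
  by apply/malgP=> m'; rewrite mcoeffZ !mcoeffU mulr_natr.
rewrite -quotmod_scaleE; exact: (subm_scale _ (Um m)).
Qed.

(* A homomorphism out of the Verma module, without naming its target as a
   module: [h] realises M inside a ring on which D acts through [f]. Without
   such a realisation the relations could make 1 (x) m vanish. *)
Lemma vket_neq0 (S : nzRingType) (f : {rmorphism Dalg -> S}) (h : V -> S) m :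
  {morph h : m m' / m + m'} ->
  (forall c m, h (c *: m) = f c%:A * h m) ->
  (forall g m, h (DS3_g g m) = f (Dg k g) * h m) ->
  (forall g m, h (DS3_d g m) = f (Dd k g) * h m) ->
  (forall t m, f (Dy k t) * h m = 0) ->
  h m != 0 -> vket m != 0.
Proof.
move=> hD hZ hg hd hy; apply: contraNneq => /eqP m0.
have h0 : h 0 = 0 by apply: (addIr (h 0)); rewrite -hD !add0r.
have hact b f1 m' : Dge0_act b f1 -> h (f1 m') = f b * h m'.
  move=> bf; elim: bf m' => [g|g|t||a c f1' f2' _ IH1 _ IH2
                            |a c f1' f2' _ IH1 _ IH2
                            |c a f1' _ IH] m'.
  - exact: hg.
  - exact: hd.
  - by rewrite hy h0.
  - by rewrite rmorph1 mul1r.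
  - by rewrite hD IH1 IH2 rmorphD mulrDl.
  - by rewrite IH1 IH2 rmorphM mulrA.
  - have -> : c *: a = c%:A * a by rewrite -scalerAl mul1r.
    by rewrite hZ IH rmorphM mulrA.
have psiZ a u : mmap f h (a *: u) = f a * mmap f h u.
  rewrite (mmapEw (msuppZ_le _ _)) mmapE big_distrr /=.
  by apply/eq_bigr=> w _; rewrite mcoeffZ rmorphM mulrA.
have psiU m' : mmap f h << m' >> = h m'.
  by transitivity (f 1 * h m'); [exact: mmapU | rewrite rmorph1 mul1r].
have psi0 u : submod_gen (@Verma_rel k V) u -> mmap f h u = 0.
  elim=> [{}u [m1 m2|b f1 m1 bf]||u1 u2 _ IH1 _ IH2|a u1 _ IH].
  - by rewrite !mmapB !psiU hD -addrA -opprD subrr.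
  - by rewrite mmapB psiZ !psiU (hact _ _ _ bf) subrr.
  - exact: mmap0.
  - by rewrite mmapD IH1 IH2 addr0.
  - by rewrite psiZ IH mulr0.
suff /psi0 : submod_gen (@Verma_rel k V) << m >>.
  by rewrite psiU => ->.
have : << m >> \in span_submod (@Verma_rel k V) by rewrite -quotmod_pi_eq0.
by move/asboolP.
Qed.

End VermaTheory.

(** * The comparison with the explicit modules *)

Section Intertwiner.
Variables (k : fieldType) (zeta : k).
Hypothesis zetaE : zeta ^+ 2 + zeta + 1 = 0.
Hypothesis char0 : [pchar k] =i pred0.
Variable M : model.
Hypothesis checkM : check M.
Variables (I : finType) (deg : I -> 'S_3) (act : 'S_3 -> I -> {ffun I -> k^o}).
Variables (num : I -> nat) (unnum : nat -> I).
Hypotheses (num_lt : forall i, (num i < (ket_max M).+1)%N)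
  (numK : cancel num unnum)
  (unnumK : forall m, (m < (ket_max M).+1)%N -> num (unnum m) = m).
Hypothesis degE : forall i, encode (deg i) = ket_deg M (num i).
Hypothesis actE : forall g i, act g i =
  (cval zeta (ket_act M (encode g) (num i)).2 : k)
    *: ket k (unnum (ket_act M (encode g) (num i)).1).

Local Notation n := (ket_max M * 12 + 11)%N.
Local Notation N := 'cV[k]_n.+1.
Local Notation Dalg := (Dalg k).
Let V := graded_module deg act.

Definition basis (j : nat) : N := vval zeta n [:: (j, (1, 0))].

Lemma basisE j (i : 'I_n.+1) : basis j i 0 = (i == j :> nat)%:R.
Proof.
rewrite mxE /= eq_sym /cval; case: eqP => _ /=; last by rewrite mul0r addr0.
by rewrite /= addr0 mul0r addr0.
Qed.

Lemma vval1 j c : vval zeta n [:: (j, c)] = cval zeta c *: basis j.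
Proof. by rewrite (vval_cons zetaE) vval_nil addr0. Qed.

Lemma col_basis (x : N) : x = \sum_j x j 0 *: basis j.
Proof.
apply/colP => i; rewrite summxE (bigD1 i) //= big1 => [|j ji].
  by rewrite mxE basisE eqxx mulr1 addr0.
by rewrite mxE basisE val_eqE eq_sym (negbTE ji) mulr0.
Qed.

Definition Vbasis (j : nat) : Verma V :=
  wact (fun u v => Dx k (tr_of u) *: v) (word (j %% 12))
    (vket (ket k (unnum (j %/ 12)) : V)).

Definition toV (x : N) : Verma V := \sum_j Dscal (x j 0) *: Vbasis j.

Lemma toV_is_zmod_morphism : zmod_morphism toV.
Proof.
move=> x y; rewrite /toV -sumrB; apply: eq_bigr => j _.
by rewrite !mxE DscalB scalerBl.
Qed.

HB.instance Definition _ :=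
  GRing.isZmodMorphism.Build N (Verma V) toV toV_is_zmod_morphism.

Lemma toVZ c x : toV (c *: x) = Dscal c *: toV x.
Proof.
rewrite /toV [RHS]scaler_sumr; apply: eq_bigr => j _.
by rewrite mxE Dscal_mul scalerA.
Qed.

Lemma toV_basis j : (j < n.+1)%N -> toV (basis j) = Vbasis j.
Proof.
move=> jn; rewrite /toV (bigD1 (Ordinal jn)) //= big1 => [|i ij].
  by rewrite basisE eqxx Dscal1 scale1r addr0.
by rewrite basisE (_ : _ == _ = false) ?Dscal0 ?scale0r //; apply/negbTE.
Qed.

(** Scalars of k are central in D, so the action of a is k-linear and can be compared on a basis. *)
Lemma toV_linear_gen (A : 'M[k]_n.+1) (a : Dalg) :
  (forall j : 'I_n.+1, toV (A *m basis j) = a *: toV (basis j)) ->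
  forall x, toV (A *m x) = a *: toV x.
Proof.
move=> Aa x; rewrite {1 2}[x]col_basis mulmx_sumr.
rewrite !(raddf_sum toV) scaler_sumr /=.
apply: eq_bigr => j _; rewrite -scalemxAr !toVZ Aa.
by rewrite (scalerA _ a) (scalerA a) Dscal_comm.
Qed.

Local Notation X := (Xmx zeta M).
Local Notation Y := (Ymx zeta M).
Local Notation G := (Gmx zeta M).
Local Notation E := (Emx zeta M).

Lemma Xmx_basis t j : (j < n.+1)%N -> X t *m basis j =
  \sum_(p <- xtable (tcode t) (j %% 12))
     (if p.1 then - basis (12 * (j %/ 12) + p.2)%N
      else basis (12 * (j %/ 12) + p.2)%N).
Proof.
move=> jn; rewrite /Xmx opval_col // /xop /cut jn.
elim: (xtable _ _) => [|[b i] r IH]; first by rewrite big_nil vval_nil.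
rewrite big_cons /= (vval_cons zetaE) IH cval_sign; case: b => /=.
  by rewrite expr1 scaleN1r.
by rewrite expr0 scale1r.
Qed.

Lemma pos_mod m i : (i < 12)%N -> ((12 * m + i) %% 12 = i)%N.
Proof. by move=> i12; rewrite mulnC modnMDl modn_small. Qed.

Lemma pos_div m i : (i < 12)%N -> ((12 * m + i) %/ 12 = m)%N.
Proof. by move=> i12; rewrite mulnC divnMDl // divn_small // addn0. Qed.

Lemma xtable_lt u i p :
  (u < 3)%N -> (i < 12)%N -> p \in xtable u i -> (p.2 < 12)%N.
Proof.
move=> u3 i12; apply/allP: p.
have /allP/(_ u) := isT : all (fun u => all (fun i =>
  all (fun p => p.2 < 12) (xtable u i)) (iota 0 12))%N (iota 0 3).
by rewrite mem_iota => /(_ u3) /allP; apply; rewrite mem_iota.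
Qed.

Lemma toVX t x : toV (X t *m x) = Dx k t *: toV x.
Proof.
apply: toV_linear_gen => j; rewrite Xmx_basis // raddf_sum /= toV_basis //.
have jm : (j %/ 12 < (ket_max M).+1)%N by rewrite ltn_div_model.
rewrite -[t in RHS]tcodeK /Vbasis.
rewrite (@xtableP _ (fun u v => Dx k (tr_of u) *: v)) ?tcode_lt ?ltn_mod //;
  first last.
- by move=> v; apply: (@Dx_quad _ _ 1 2 0 isT isT isT); rewrite tcode_tr.
- by move=> v; apply: (@Dx_quad _ _ 1 0 2 isT isT isT); rewrite tcode_tr.
- by move=> u v; rewrite scalerA (DrelP (Drel_xx _ _ _ _ _)) scale0r.
- by move=> u v w; rewrite scalerBr.
rewrite !big_seq; apply: eq_bigr => p.
move=> /(xtable_lt (tcode_lt t) (ltn_pmod j (isT : 0 < 12)%N)) p12.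
have pn : (12 * (j %/ 12) + p.2 < n.+1)%N.
  by rewrite -ltn_div_model pos_div.
by case: ifP => _; rewrite ?raddfN /= toV_basis // /Vbasis pos_mod // pos_div.
Qed.

Lemma words_ind (P : nat -> Prop) : P 0%N ->
  (forall u i j, (u < 3)%N -> (i < 12)%N -> xtable u i = [:: (false, j)] ->
    P i -> P j) ->
  forall i, (i < 12)%N -> P i.
Proof.
move=> P0 PS.
(* The arguments of [PS] are the first letter of the word and the index of its tail. *)
have P1 : P 1%N by apply: (PS 0 0)%N.
have P2 : P 2%N by apply: (PS 1 0)%N.
have P3 : P 3%N by apply: (PS 2 0)%N.
have P4 : P 4%N by apply: (PS 0 2)%N.
have P5 : P 5%N by apply: (PS 0 3)%N.
have P6 : P 6%N by apply: (PS 1 1)%N.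
have P7 : P 7%N by apply: (PS 1 3)%N.
have P8 : P 8%N by apply: (PS 0 6)%N.
have P9 : P 9%N by apply: (PS 0 7)%N.
have P10 : P 10%N by apply: (PS 1 5)%N.
have P11 : P 11%N by apply: (PS 0 10)%N.
by case=> [|[|[|[|[|[|[|[|[|[|[|[|i]]]]]]]]]]]].
Qed.

(* The basis being generated by the x's, commutation relations with the x's
   reduce an intertwining property to the highest weight vectors. *)
Lemma basis_ind (P : N -> Prop) :
  (forall m, (m < (ket_max M).+1)%N -> P (basis (12 * m)%N)) ->
  (forall t j, P (basis j) -> P (X t *m basis j)) ->
  forall j : 'I_n.+1, P (basis j).
Proof.
move=> P0 PX j; have jm : (j %/ 12 < (ket_max M).+1)%N by rewrite ltn_div_model.
suff H i : (i < 12)%N -> P (basis (12 * (j %/ 12) + i)%N).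
  by rewrite (divn_eq j 12) mulnC; apply: H; rewrite ltn_mod.
apply: (@words_ind (fun i => P (basis (12 * (j %/ 12) + i)%N))).
  by rewrite addn0; apply: P0.
move=> u {}i j' u3 i12 xE Pi.
have := PX (tr_of u) _ Pi; rewrite Xmx_basis; last first.
  by rewrite -ltn_div_model pos_div.
by rewrite tr_ofK // pos_mod // pos_div // xE big_seq1.
Qed.

Lemma ltn_base m : (m < (ket_max M).+1)%N -> (12 * m < n.+1)%N.
Proof. by rewrite -ltn_div_model mulKn. Qed.

Lemma toV_base m : (m < (ket_max M).+1)%N ->
  toV (basis (12 * m)%N) = vket (ket k (unnum m) : V).
Proof.
by move=> mM; rewrite toV_basis ?ltn_base // /Vbasis mulKn // modnMr.
Qed.

Lemma vket_g_ket g m : (m < (ket_max M).+1)%N ->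
  Dg k g *: vket (ket k (unnum m) : V) =
  Dscal (cval zeta (ket_act M (encode g) m).2)
    *: vket (ket k (unnum (ket_act M (encode g) m).1) : V).
Proof.
move=> mM; rewrite vket_g -vketZ; congr vket.
rewrite /= /lin_ext (bigD1 (unnum m)) //= big1 => [|i im].
  by rewrite ffunE eqxx scale1r addr0 actE unnumK.
by rewrite ffunE (negbTE im) scale0r.
Qed.

Lemma vket_d_ket h m : (m < (ket_max M).+1)%N ->
  Dd k h *: vket (ket k (unnum m) : V) =
  if ket_deg M m == encode h then vket (ket k (unnum m) : V) else 0.
Proof.
move=> mM; rewrite vket_d /= /lin_ext (bigD1 (unnum m)) //= big1 => [|i im].
  rewrite ffunE eqxx scale1r addr0 -encode_eq degE unnumK //.
  by case: eqP => // _; rewrite vket0.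
by rewrite ffunE (negbTE im) scale0r.
Qed.

Lemma ket_act_lt g m : (m < (ket_max M).+1)%N ->
  ((ket_act M (encode g) m).1 < (ket_max M).+1)%N.
Proof.
move=> mM; have /and4P[_ _ _ /allP/(_ m)] := checkM.
rewrite mem_iota => /(_ mM) /andP[_ /allP]; apply; exact: encode_mem.
Qed.

Lemma Gmx_base g m : (m < (ket_max M).+1)%N -> G g *m basis (12 * m)%N =
  cval zeta (ket_act M (encode g) m).2
    *: basis (12 * (ket_act M (encode g) m).1)%N.
Proof.
move=> mM; have mn := ltn_base mM.
by rewrite /Gmx opval_col // /gop /cut mn modnMr mulKn // vval1.
Qed.

Lemma Emx_base h m : (m < (ket_max M).+1)%N -> E h *m basis (12 * m)%N =
  if ket_deg M m == encode h then basis (12 * m)%N else 0.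
Proof.
move=> mM; have mn := ltn_base mM.
rewrite /Emx opval_col // /dop /cut mn modnMr mulKn //=.
by case: eqP => _; rewrite ?vval_nil.
Qed.

Lemma Ymx_base s m : (m < (ket_max M).+1)%N -> Y s *m basis (12 * m)%N = 0.
Proof.
move=> mM; have mn := ltn_base mM.
by rewrite /Ymx opval_col // /yop /cut mn modnMr mulKn //= vval_nil.
Qed.

Let rel := model_rel zetaE checkM.

Lemma toVG g x : toV (G g *m x) = Dg k g *: toV x.
Proof.
apply: toV_linear_gen => j; move: g.
apply: (basis_ind (P := fun x => forall g, toV (G g *m x) = Dg k g *: toV x))
  => {j} [m mM g|t j IH g].
  by rewrite (Gmx_base g mM) toVZ (toV_base (ket_act_lt g mM)) (toV_base mM)
    (vket_g_ket g mM).
have -> : G g *m (X t *m basis j) =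
    sgn3 k g *: (X (conjT g t) *m (G g *m basis j)).
  rewrite !mulmxA scalemxAl; congr (_ *m _).
  exact: rel (Drel_gx _ _ _ _ g t).
rewrite toVZ !toVX IH (scalerA (Dg k g)) (DrelP (Drel_gx _ _ _ _ g t)).
by rewrite [RHS]Dscal_scale [X in _ = _ *: X](esym (scalerA _ _ _)).
Qed.

Lemma toVE h x : toV (E h *m x) = Dd k h *: toV x.
Proof.
apply: toV_linear_gen => j; move: h.
apply: (basis_ind (P := fun x => forall h, toV (E h *m x) = Dd k h *: toV x))
  => {j} [m mM h|t j IH h].
  rewrite (Emx_base h mM) (toV_base mM) (vket_d_ket h mM).
  by case: eqP => _; [rewrite (toV_base mM) | rewrite (raddf0 toV)].
have -> : E h *m (X t *m basis j) = X t *m (E (mul3 (val t) h) *m basis j).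
  by rewrite !mulmxA; congr (_ *m _); apply: rel (Drel_dx _ _ _ _ h t).
rewrite !toVX IH (scalerA (Dx k t)) (scalerA (Dd k h)).
by rewrite (DrelP (Drel_dx _ _ _ _ h t)).
Qed.

Lemma toVY s x : toV (Y s *m x) = Dy k s *: toV x.
Proof.
(* The induction is over all s at once, because passing x_t turns y_s into y_(tst). *)
apply: toV_linear_gen => j; move: s.
apply: (basis_ind (P := fun x => forall s, toV (Y s *m x) = Dy k s *: toV x))
  => {j} [m mM s|t j IH s].
  by rewrite (Ymx_base s mM) (toV_base mM) (raddf0 toV) vket_y.
have -> : Y s *m (X t *m basis j) =
    G (val t) *m (E (val s) *m basis j - E (mul3 (val s) (val t)) *m basis j)
    + (if s == t then basis j else 0) - X t *m (Y (conjT (val t) s) *m basis j).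
  rewrite mulmxA [Y s *m X t](Drel_yx rel) -!mulmxE mulmxBl mulmxDl.
  rewrite -!mulmxA mulmxBl.
  by congr (_ + _ - _); case: eqP; rewrite ?mul1mx ?mul0mx.
rewrite toVX (scalerA (Dy k s)) (Drel_yx (@DrelP k)) raddfB raddfD /=.
rewrite toVG raddfB /= !toVE toVX IH.
rewrite cross_scale; congr (_ + _ - _).
by case: eqP => _; [rewrite scale1r | rewrite scale0r (raddf0 toV)].
Qed.

(** * Generation by kets and simplicity *)

Section Simplicity.
Variable f : {rmorphism Dalg -> 'M[k]_n.+1}.
Hypotheses (fZ : forall c a, f (c *: a) = c *: f a)
  (fX : forall t, f (Dx k t) = X t)
  (fY : forall t, f (Dy k t) = Y t) (fG : forall g, f (Dg k g) = G g)
  (fE : forall h, f (Dd k h) = E h).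

Lemma toV_act a x : toV (f a *m x) = a *: toV x.
Proof.
move: a x; apply: Dalg_ind
  => [x|a b IHa IHb x|a b IHa IHb x|c a IHa x|t x|t x|g x|h x].
- by rewrite rmorph1 mul1mx scale1r.
- by rewrite rmorphD mulmxDl (raddfD toV) /= IHa IHb scalerDl.
- by rewrite rmorphM -mulmxA IHa IHb scalerA.
- by rewrite fZ -scalemxAl toVZ IHa [RHS]Dscal_scale.
- by rewrite fX toVX.
- by rewrite fY toVY.
- by rewrite fG toVG.
- by rewrite fE toVE.
Qed.

Lemma vket_expand (m : V) :
  vket m = \sum_i Dscal (m i : k) *: vket (ket k i : V).
Proof.
rewrite {1}(_ : m = \sum_i (m i : k) *: (ket k i : V)).
  by rewrite vket_sum; apply: eq_bigr => i _; rewrite vketZ.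
apply/ffunP => j; rewrite sum_ffunE (bigD1 j) //= big1 => [|i ij].
  by rewrite !ffunE eqxx addr0 [RHS]mulr1.
by rewrite !ffunE eq_sym (negbTE ij) [LHS]mulr0.
Qed.

Lemma vket_full (U : submodule (Verma V)) :
  (forall i, vket (ket k i : V) \in U) -> U =i predT.
Proof.
move=> Ui; apply: vket_gen => m; rewrite vket_expand.
elim/big_rec: _ => [|i v _ Uv]; first exact: subm0.
by apply: submD => //; apply: subm_scale.
Qed.

(** By [toV_act] the image is stable under D, and it contains the kets, which generate. *)
Lemma toV_surj v : exists x, v = toV x.
Proof.
have im_closed : GRing.submod_closed (fun v => `[< exists x, v = toV x >]).
  split=> [|a u w]; first by apply/asboolP; exists 0; rewrite (raddf0 toV).
  rewrite !unfold_in => /asboolP[x ->] /asboolP[y ->]; apply/asboolP.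
  by exists (f a *m x + y); rewrite (raddfD toV) /= toV_act.
suff /(_ v) : Submodule im_closed =i predT by rewrite [RHS]inE => /asboolP.
apply: vket_full => i; apply/asboolP; exists (basis (12 * num i)%N).
by rewrite toV_base // numK.
Qed.

Lemma vket_ket_neq0 i : vket (ket k i : V) != 0.
Proof.
(* The target in [vket_neq0] is a ring, so a column vector is stored as the 0-th column of a square
   matrix; left multiplication still acts on it as on a column. *)
pose r : 'rV[k]_n.+1 := delta_mx 0 0.
pose h (m : V) : 'M[k]_n.+1 := (\sum_j (m j : k) *: basis (12 * num j)%N) *m r.
have fscal c : f c%:A = c%:M by rewrite fZ rmorph1 scalemx1.
have hD : {morph h : m m' / m + m'}.
  move=> m m'; rewrite /h -mulmxDl -big_split; congr (_ *m _).
  by apply: eq_bigr => j _; rewrite ffunE scalerDl.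
have hZ c m : h (c *: m) = c *: h m.
  rewrite /h scalemxAl scaler_sumr; congr (_ *m _).
  by apply: eq_bigr => j _; rewrite ffunE scalerA.
have h_ket j : h (ket k j) = basis (12 * num j)%N *m r.
  rewrite /h (bigD1 j) //= big1 => [|l lj].
    by rewrite ffunE eqxx scale1r addr0.
  by rewrite ffunE (negbTE lj) scale0r.
have h0 : h 0 = 0 by apply: (addIr (h 0)); rewrite -hD !add0r.
have h_sum (F : I -> V) : h (\sum_j F j) = \sum_j h (F j).
  exact: (big_morph h hD h0).
have h_lin (A : 'M[k]_n.+1) (F : I -> V) (m : V) :
    (forall j, h (F j) = A *m h (ket k j)) -> h (lin_ext F m) = A *m h m.
  move=> hF; rewrite h_sum {2}/h mulmxA mulmx_sumr mulmx_suml.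
  apply: eq_bigr => j _.
  by rewrite hZ hF h_ket -scalemxAr -scalemxAl mulmxA.
apply: (@vket_neq0 k V _ f h) => //.
- by move=> c m; rewrite hZ fscal -mul_scalar_mx.
- move=> g m; rewrite fG; apply: h_lin => j.
  by rewrite actE hZ !h_ket mulmxA Gmx_base // -scalemxAl unnumK // ket_act_lt.
- move=> g m; rewrite fE; apply: h_lin => j.
  rewrite -encode_eq degE h_ket mulmxA Emx_base //; case: ifP => _.
    by rewrite h_ket.
  by rewrite mul0mx h0.
- move=> t m; rewrite fY -mulmxE {1}/h mulmxA mulmx_sumr big1 ?mul0mx // => j _.
  by rewrite -scalemxAr Ymx_base ?scaler0.
rewrite h_ket; apply/eqP => /matrixP/(_ (inord (12 * num i)) 0).
rewrite mxE big_ord1 basisE inordK ?ltn_base // eqxx mul1r !mxE eqxx.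
by move/eqP; rewrite oner_eq0.
Qed.

(** The operator [dual_op] is the image of an element of D, namely a projection delta_h times y_top
    times the j-th dual word in the x's. *)
Lemma dual_action (j : 'I_n.+1) : exists a c, c != 0 /\
  forall x, f a *m x = (c * x j 0) *: basis (12 * (j %/ 12))%N.
Proof.
have /and4P[_ /allP/(_ (val j)) dualj _ _] := checkM.
move: dualj; rewrite mem_iota => /(_ (ltn_ord j)) /and3P[c1 c2 /op_eqP dE].
pose xs w : Dalg := foldr (fun u a => Dx k (tr_of u) * a) 1 w.
have xsE w : all (fun u => u < 3)%N w ->
    f (xs w) = opval zeta n (foldr (fun u => opM (xop M u)) (op1 M) w).
  elim: w => [_|u w IH /= /andP[u3 /IH wE]]; first by rewrite rmorph1 opval1.
  rewrite rmorphM wE fX /Xmx tr_ofK // -mulmxE opvalM //; exact: cut_supported.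
have w3 : all (fun u => u < 3)%N (nth [::] dual_words (j %% 12)).
  have /all_nthP := isT : all (all (fun u => u < 3)%N) dual_words.
  by apply; rewrite ltn_mod.
pose y u := Dy k (tr_of u).
have yE u : (u < 3)%N -> f (y u) = opval zeta n (yop M u).
  by move=> u3; rewrite fY /Ymx tr_ofK.
have jm : (j %/ 12 < (ket_max M).+1)%N by rewrite ltn_div_model.
have code_deg : is_code (ket_deg M (j %/ 12)).
  by rewrite -(unnumK jm) -degE encode_code.
exists (Dd k (decode (ket_deg M (j %/ 12))) *
  (y 0%N * (y 1%N * (y 0%N * (y 2%N * xs (nth [::] dual_words (j %% 12))))))).
exists (cval zeta (vcoef (dual_op M j j) (12 * (j %/ 12)))); split.
  rewrite /cval (eqP c2) mul0r addr0; have natf0 := (pcharf0P k).1 char0.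
  move: c1; set z := (vcoef _ _).1; case: (z) => p p0.
    by rewrite -pmulrn natf0.
  by rewrite NegzE mulrNz oppr_eq0 -pmulrn natf0.
move=> x; rewrite !rmorphM fE /Emx decodeK // !yE // xsE // -!mulmxE.
rewrite !opvalM //; try exact: cut_supported.
rewrite [opM _ _]/(dual_op M j) dE; apply/colP => i.
rewrite !mxE (bigD1 j) //= big1 => [|l lj]; last first.
  by rewrite !mxE val_eqE (negbTE lj) cval0 mul0r.
rewrite !mxE eqxx /= addr0 mulrAC; congr (_ * _).
have coef_add0 d : coef_add d (0, 0) = d.
  by case: d => a b; rewrite /coef_add /= !addr0.
rewrite !coef_add0; case: eqP => _; last by rewrite !cval0 mulr0.
by rewrite [cval zeta (1, 0)]/cval mul0r addr0 mulr1.
Qed.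

Lemma Verma_simple : simple_module (Verma V).
Proof.
split; first by exists (vket (ket k (unnum 0) : V)); apply: vket_ket_neq0.
move=> U.
have [[v [Uv v0]]|U0] := pselect (exists v, v \in U /\ v != 0); last first.
  left=> v; rewrite [RHS]inE; apply/idP/eqP => [Uv|->]; last exact: subm0.
  by apply/eqP; apply: contrapT => /negP v0; apply: U0; exists v.
right; have [x vE] := toV_surj v.
(* Here v != 0 forces x != 0, and a single nonzero coordinate is enough for [dual_action]. *)
have [j xj] : exists j, x j 0 != 0.
  apply: contrapT => xz; case/eqP: v0; rewrite vE (_ : x = 0) ?(raddf0 toV) //.
  apply/colP => j; rewrite mxE; apply/eqP/negPn/negP => xj.
  by apply: xz; exists j.
have [a [c [c0 aE]]] := dual_action j.
have jm : (j %/ 12 < (ket_max M).+1)%N by rewrite ltn_div_model.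
have Uj : vket (ket k (unnum (j %/ 12)) : V) \in U.
  have d0 : c * x j 0 != 0 by rewrite mulf_neq0.
  have : Dscal (c * x j 0)^-1 *: (a *: v) \in U by do 2!apply: subm_scale.
  by rewrite vE -toV_act aE -toVZ scalerA mulVf // scale1r toV_base.
apply: vket_full => i; have := num_lt i.
have /and4P[_ _ /allP/(_ (j %/ 12)%N) H _] := checkM.
move: H; rewrite mem_iota => /(_ jm) /allP/(_ (num i)).
rewrite mem_iota => H /H /hasP[b].
rewrite mem_codes => b3 /eqP bE.
have := subm_scale (Dg k (decode b)) Uj.
rewrite vket_g_ket // decodeK // bE /= numK.
by rewrite /cval mul0r addr0 Dscal1 scale1r.
Qed.

End Simplicity.

End Intertwiner.

(** * The four weights *)

Section Weights.
Variable k : fieldType.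
Hypothesis char0 : [pchar k] =i pred0.

Lemma Verma_model_simple (zeta : k) (M : model) (I : finType) (deg : I -> 'S_3)
    (act : 'S_3 -> I -> {ffun I -> k^o}) (num : I -> nat) (unnum : nat -> I) :
  zeta ^+ 2 + zeta + 1 = 0 -> check M ->
  (forall i, (num i < (ket_max M).+1)%N) -> cancel num unnum ->
  (forall m, (m < (ket_max M).+1)%N -> num (unnum m) = m) ->
  (forall i, encode (deg i) = ket_deg M (num i)) ->
  (forall g i, act g i = (cval zeta (ket_act M (encode g) (num i)).2 : k)
                           *: ket k (unnum (ket_act M (encode g) (num i)).1)) ->
  simple_module (Verma (graded_module deg act)).
Proof.
move=> zetaE checkM num_lt numK unnumK degE actE.
have [f [fZ fX fY fG fE]] := Dalg_universal (model_rel zetaE checkM).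
exact: (Verma_simple zetaE char0 checkM num_lt numK unnumK degE actE
  fZ fX fY fG fE).
Qed.

Variable zeta : k.
Hypothesis zetaE : zeta ^+ 2 + zeta + 1 = 0.

Lemma cval10 : cval zeta (1, 0) = 1.
Proof. by rewrite /cval mul0r addr0. Qed.

Lemma Verma_e_minus_simple : simple_module (Verma (M_e_minus k)).
Proof.
apply: (Verma_model_simple (num := fun=> 0%N) (unnum := fun=> tt)
  zetaE check_e_minus) => //.
- by case.
- by case.
- by move=> i; rewrite encode1.
- by move=> g [] /=; rewrite cval_sign.
Qed.

Lemma Verma_sigma_plus_simple : simple_module (Verma (M_sigma_plus k)).
Proof.
apply: (Verma_model_simple (num := tcode) (unnum := tr_of)
  zetaE check_sigma_plus) => //.
- exact: tcode_lt.
- exact: tcodeK.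
- exact: tr_ofK.
- exact: encode_transp.
- by move=> g t /=; rewrite cval10 scale1r -tcode_conj tcodeK.
Qed.

Lemma encode_tau : encode tau = (false, 1%N).
Proof. by rewrite -(decodeK (a := (false, 1%N))) // /decode /= expg1. Qed.

Lemma Verma_tau1_simple : simple_module (Verma (M_tau zeta 1)).
Proof.
have zeta2 : zeta ^+ 2 = -1 - zeta.
  by apply/eqP; rewrite -subr_eq0 -zetaE; apply/eqP; ring.
have zeta3 : zeta ^+ 3 = 1.
  by apply/eqP; rewrite -subr_eq0 -(mulr0 (zeta - 1)) -zetaE; apply/eqP; ring.
pose pow := [:: (1, 0); (0, 1); (-1, -1)] : seq coef.
have powE t : cval zeta (nth (1, 0) pow (t %% 3)%N) = zeta ^+ t.
  rewrite {2}(divn_eq t 3) mulnC exprD exprM zeta3 expr1n mul1r.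
  case: (t %% 3)%N (ltn_pmod t (isT : 0 < 3)%N) => [|[|[|//]]] _ /=.
  - by rewrite cval10.
  - by rewrite /cval add0r mul1r.
  - by rewrite zeta2 /cval /= mulN1r.
have powV t : (t < 3)%N -> zeta ^+ (3 - t) = zeta ^- t.
  move=> t3; have zt0 : zeta ^+ t != 0.
    rewrite expf_neq0 //; apply/eqP => z0; move: zeta3.
    by rewrite z0 expr0n => /eqP; rewrite eq_sym oner_eq0.
  by apply: (mulIf zt0); rewrite -exprD subnK ?zeta3 ?mulVf // ltnW.
(* The negation is there because [true] stands for |tau>, which is ket 0. *)
apply: (Verma_model_simple (num := fun s : bool => (~~ s : nat))
  (unnum := fun m => m == 0%N) zetaE check_tau) => //.
- by case.
- by case.
- by move=> [|[|m]].
- by case; rewrite /= ?encodeV encode_tau.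
- move=> g s /=; rewrite powE muln1; congr (_ *: ket _ _).
    by case: s => //=; rewrite powV //; apply: (encode_code g).
  by case: s; case: (odd_perm g).
Qed.

End Weights.

(** The weight l enters only through powers of zeta^l, and zeta^2 is again a root of z^2 + z + 1, so
    the model for l = 1 covers l = 2 as well. *)
Lemma M_tau2 (k : fieldType) (zeta : k) : M_tau zeta 2 = M_tau (zeta ^+ 2) 1.
Proof.
rewrite /M_tau; congr graded_module; apply/funext => g; apply/funext => s.
by rewrite muln1 -!exprM mulnC.
Qed.

Theorem theorem6 (k : closedFieldType) (char0 : [pchar k] =i pred0)
    (zeta : k) (zeta_prim : 3.-primitive_root zeta) :
  [/\ simple_module (Verma (M_e_minus k)),
      simple_module (Verma (M_sigma_plus k)),
      simple_module (Verma (M_tau zeta 1)) &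
      simple_module (Verma (M_tau zeta 2))]
  /\
  [/\ isomorphic (Lhead (M_e_minus k)) (Ssocle (M_e_minus k)),
      isomorphic (Lhead (M_sigma_plus k)) (Ssocle (M_sigma_plus k)),
      isomorphic (Lhead (M_tau zeta 1)) (Ssocle (M_tau zeta 1)) &
      isomorphic (Lhead (M_tau zeta 2)) (Ssocle (M_tau zeta 2))].
Proof.
have zeta3 := prim_expr_order zeta_prim.
have zeta1 : zeta - 1 != 0.
  rewrite subr_eq0; apply/eqP => z1.
  by have := prim_order_dvd zeta_prim 1; rewrite z1 expr1n eqxx.
have zetaE : zeta ^+ 2 + zeta + 1 = 0.
  apply: (mulfI zeta1); rewrite mulr0.
  by transitivity (zeta ^+ 3 - 1); [ring | rewrite zeta3 subrr].
have zeta2E : (zeta ^+ 2) ^+ 2 + zeta ^+ 2 + 1 = 0.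
  transitivity ((zeta ^+ 2 + zeta + 1) * (zeta ^+ 2 - zeta + 1)); first by ring.
  by rewrite zetaE mul0r.
have Me := Verma_e_minus_simple char0 zetaE.
have Ms := Verma_sigma_plus_simple char0 zetaE.
have Mt1 := Verma_tau1_simple char0 zetaE.
have Mt2 := Verma_tau1_simple char0 zeta2E.
by rewrite M_tau2; split; split=> //; apply: simple_head_socle.
Qed.
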